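(* Let $\Omega_{\mathcal{F}}\subset\mathcal{A}^{\mathbb{Z}^d}$ be an SFT. Assume there is a sequence of triplets $(p_n,\rho_n,C_n)$ such that, for every $n$, $\Omega_{\mathcal{F}}$ is $\rho_n$-almost $p_n$-periodic with the $C_n$-reconstruction property. Then, as soon as $\rho_n\to0$, $\Omega_{\mathcal{F}}$ is a stable SFT.
   Context: **SFTs and noise.** Let $\mathcal{A}$ be a finite alphabet, $\Omega_{\mathcal{A}}=\mathcal{A}^{\mathbb{Z}^d}$ with the product topology, Borel $\sigma$-algebra and shifts $\sigma_k(\omega)_l=\omega_{k+l}$ ($k\in\mathbb{Z}^d$). For a finite set $\mathcal{F}$ of forbidden patterns $w\in\mathcal{A}^{I(w)}$ ($I(w)\subset\mathbb{Z}^d$ finite), $\Omega_{\mathcal{F}}$ is the set of $\omega\in\Omega_{\mathcal{A}}$ with $\sigma_k(\omega)|_{I(w)}\neq w$ for all $w\in\mathcal{F}$, $k\in\mathbb{Z}^d$. $\mathcal{M}_{\mathcal{F}}$ is the set of $\sigma$-invariant Borel probability measures supported by $\Omega_{\mathcal{F}}$. Put $\widetilde{\mathcal{A}}=\mathcal{A}\times\{0,1\}$, with coordinate projections $\pi_1,\pi_2$, and $\widetilde{\mathcal{F}}=\{(w,0^{I(w)}):w\in\mathcal{F}\}$, a set of forbidden patterns on $\widetilde{\mathcal{A}}$. $\widetilde{\mathcal{M}_{\mathcal{F}}^{\mathcal{B}}}(\epsilon)$ is the set of $\lambda\in\mathcal{M}_{\widetilde{\mathcal{F}}}$ whose pushforward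 $\pi_2^*(\lambda)$ is an i.i.d. Bernoulli measure $\mathcal{B}(\epsilon')^{\otimes\mathbb{Z}^d}$ with $\epsilon'\in[0,1]$, $\epsilon'\le\epsilon$, and $\mathcal{M}_{\mathcal{F}}^{\mathcal{B}}(\epsilon)=\pi_1^*\big(\widetilde{\mathcal{M}_{\mathcal{F}}^{\mathcal{B}}}(\epsilon)\big)$. **Besicovitch distance.** $d_H(x,y)=\limsup_{n\to\infty}\frac{1}{(2n+1)^d}\#\{k\in\{-n,\dots,n\}^d:x_k\neq y_k\}$ for $x,y\in\Omega_{\mathcal{A}}$. For $\sigma$-invariant measures, $d_B(\mu,\nu)=\inf_{\lambda}\int d_H(x,y)\,d\lambda(x,y)$, the infimum being over $\sigma$-invariant couplings $\lambda$ of $\mu$ and $\nu$ on $\Omega_{\mathcal{A}\times\mathcal{A}}$. $d_B(\mu,V)=\inf_{\nu\in V}d_B(\mu,\nu)$ for a set $V$. **Stability.** $\Omega_{\mathcal{F}}$ is stable if there is a non-decreasing $f:[0,1]\to[0,\infty)$, continuous at $0$ with $f(0)=0$, such that $\sup_{\mu\in\mathcal{M}_{\mathcal{F}}^{\mathcal{B}}(\epsilon)}d_B(\mu,\mathcal{M}_{\mathcal{F}})\le f(\epsilon)$ for all $\epsilon\in[0,1]$. (Speaking of stability presupposes $\Omega_{\mathcal{F}}\neq\emptyset$.) **Almost periodic SFT.** Let $p\in\mathbb{N}$, $p\ge1$, and $\rho>0$. $\Omega_{\mathcal{F}}$ is $\rho$-almost $p$-periodic if there is a set $G\subset\mathbb{Z}^d$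 (the grid), invariant under translations in $(p\mathbb{Z})^d$ and of density at most $\rho$, such that for any $\omega\in\Omega_{\mathcal{F}}$ there is a unique translate $G+k$ of $G$ (given by a not necessarily unique $k\in\{0,\dots,p-1\}^d$) for which the restriction $\omega|_{G^c+k}$ to the complement of $G+k$ is $p$-periodic (invariant under translations in $(p\mathbb{Z})^d$). In this case, with a blank symbol $\square\notin\mathcal{A}$, $\omega^\square$ is obtained from $\omega$ by overwriting $\omega|_{G+k}$ with $\square$, and $\Omega_{\mathcal{F}}^\square=\{\omega^\square:\omega\in\Omega_{\mathcal{F}}\}$, which is a finite $p$-periodic SFT. **$C$-reconstruction.** Let $B_n=\{-n,\dots,n\}^d$. A pattern is locally admissible if it contains no forbidden pattern of $\mathcal{F}$, and globally admissible in a subshift if it is the restriction of a configuration of it. A $\rho$-almost $p$-periodic SFT with grid $G$ has the $C$-reconstruction property if, for any locally admissible tiling $\omega$ of $B_{\lceil p/2\rceil+C}$, there is a unique translate $G+k$ of $G$ such that the pattern on $B_{\lceil p/2\rceil}$ equal to $\omega$ on $B_{\lceil p/2\rceil}\cap(G^c+k)$ and to $\square$ on $B_{\lceil p/2\rceil}\cap(G+k)$ is globally admissible in $\Omega_{\mathcal{F}}^\square$ (thence the restriction of $\omega$ to $B_{\lceil p/2\rceil}\cap(G^c+k)$ is globally admissible in $\Omega_{\mathcal{F}}$); moreover this translate of $G$ depends only on what happens in any $p$-square (cube of side $p$) included in the central window $B_{\lceil p/2\rceil}$.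
   Formalization: The dimension is assumed to be d ≥ 2; for d = 1 the claim fails, e.g. forbidden words 00 and 11 on {0,1} (p = 2, empty grid, C = 0), where noise of any rate ε > 0 with independent phases between obscured cells gives Besicovitch distance 1/2. *)

(* Defs.v *)
From HB Require Import structures.
From mathcomp Require Import all_boot all_order all_algebra finmap.
From mathcomp Require Import all_classical all_reals all_analysis.

Set Implicit Arguments.
Unset Strict Implicit.
Unset Printing Implicit Defensive.

Import Order.TTheory GRing.Theory Num.Theory.
Import numFieldNormedType.Exports.

Local Open Scope classical_set_scope.
Local Open Scope ring_scope.

(* A [measurableType] has to be pointed, hence so does the alphabet.  This only
   excludes the empty alphabet; no definition below depends on the point. *)
#[short(type="alphabetType")]
HB.structure Definition Alphabet := {T of Finite T & Pointed T}.

HB.instance Definition _ := Pointed.on bool.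
HB.instance Definition _ (A B : alphabetType) := Pointed.on (A * B)%type.

Section Lattice.
Variable d : nat.
Local Notation Zd := 'rV[int]_d.

Definition box (n : nat) : set Zd := [set k | forall i, `|k 0 i| <= n%:Z].

Definition cube (p : nat) : set Zd := [set k | forall i, 0 <= k 0 i < p%:Z].

Definition translate (k : Zd) (S : set Zd) : set Zd := [set j + k | j in S].

(* For subsets of Z^d invariant under (pZ)^d, p > 0, this limsup is a limit. *)
Definition density (R : realType) (S : set Zd) : \bar R :=
  limn_esup (fun n : nat =>
    ((#|` fset_set (S `&` box n)|)%:R / ((n.*2.+1 ^ d)%N)%:R : R)%:E).

Definition periodic_set (p : nat) (S : set Zd) : Prop :=
  forall j v : Zd, S (j + v *+ p) <-> S j.

End Lattice.

Section SFT.
Variable d : nat.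
Local Notation Zd := 'rV[int]_d.

Definition conf (A : Type) : Type := Zd -> A.

Definition shift_conf (A : Type) (k : Zd) (x : conf A) : conf A := fun l => x (k + l).

(* The domain of the finite map [w] is the window I(w). *)
Definition pattern (A : choiceType) := {fmap Zd -> A}.

Definition matches (A : choiceType) (w : pattern A) (x : conf A) : Prop :=
  forall i, i \in domf w -> w.[? i]%fmap = Some (x i).

Definition SFT (A : choiceType) (F : {fset pattern A}) : set (conf A) :=
  [set x | forall w k, w \in F -> ~ matches w (shift_conf k x)].

(* Patterns on a window D are given by configurations, of which only the values
   on D are used. *)
Definition locally_admissible (A : choiceType) (F : {fset pattern A})
    (D : set Zd) (x : conf A) : Prop :=
  forall w k, w \in F -> (forall i, i \in domf w -> D (k + i)) ->
    ~ matches w (shift_conf k x).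

Definition globally_admissible (A : Type) (X : set (conf A))
    (D : set Zd) (x : conf A) : Prop :=
  exists2 y, X y & forall j, D j -> y j = x j.

(* Second component: [true] is an obscured (noisy) cell, [false] a clear one. *)
Definition clear_pattern (A : choiceType) (w : pattern A) :
    pattern (A * bool)%type :=
  [fmap i : domf w => (w i, false)]%fmap.

Definition noisy_patterns (A : choiceType) (F : {fset pattern A}) :
    {fset pattern (A * bool)%type} :=
  [fset clear_pattern w | w in F]%fset.

Definition hamming (R : realType) (A : Type) (x y : conf A) : \bar R :=
  density R [set k | x k <> y k].

End SFT.

Section Measures.
Variables (R : realType) (d : nat).
Local Notation Zd := 'rV[int]_d.

Definition borel_conf (A : alphabetType) :=
  g_sigma_algebraType
    (@open (prod_topology (fun _ : Zd => discrete_topology A))).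

Definition conf1 (A B : alphabetType) (z : borel_conf (A * B)%type) :
  borel_conf A := fun k => (z k).1.

Definition conf2 (A B : alphabetType) (z : borel_conf (A * B)%type) :
  borel_conf B := fun k => (z k).2.

Definition shift_invariant (A : alphabetType)
    (mu : probability (borel_conf A) R) : Prop :=
  forall (k : Zd) (B : set (borel_conf A)), measurable B ->
    mu (@shift_conf d A k @^-1` B) = mu B.

Definition invariant_measures (A : alphabetType) (F : {fset pattern d A}) :
    set (probability (borel_conf A) R) :=
  [set mu | shift_invariant mu /\ mu (SFT F) = 1%E].

(* Equality of measures is stated on measurable sets, as a measure takes
   unspecified values elsewhere. *)
Definition same_measure (A : alphabetType)
    (mu nu : set (borel_conf A) -> \bar R) : Prop :=
  forall B : set (borel_conf A), measurable B -> mu B = nu B.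

(* Values of the product measure B(q)^(Z^d) on finite-dimensional rectangles,
   which characterise it. *)
Definition is_bernoulli_product (q : R)
    (nu : set (borel_conf bool) -> \bar R) : Prop :=
  forall (J : {fset Zd}) (E : Zd -> set bool),
    nu [set x | forall j, j \in J -> E j (x j)] =
    (\prod_(j <- J) bernoulli_prob q (E j))%E.

Definition noisy_joint_measures (A : alphabetType) (F : {fset pattern d A})
    (eps : R) : set (probability (borel_conf (A * bool)%type) R) :=
  [set lambda | invariant_measures (noisy_patterns F) lambda /\
    exists q : R, [/\ 0 <= q <= 1, q <= eps &
      is_bernoulli_product q (pushforward lambda (@conf2 A bool))]].

Definition noisy_measures (A : alphabetType) (F : {fset pattern d A})
    (eps : R) : set (probability (borel_conf A) R) :=
  [set mu | exists2 lambda, noisy_joint_measures F eps lambda &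
    same_measure (pushforward lambda (@conf1 A bool)) mu].

Definition couplings (A : alphabetType) (mu nu : probability (borel_conf A) R) :
    set (probability (borel_conf (A * A)%type) R) :=
  [set lambda | [/\ shift_invariant lambda,
    same_measure (pushforward lambda (@conf1 A A)) mu &
    same_measure (pushforward lambda (@conf2 A A)) nu]].

Definition besicovitch (A : alphabetType)
    (mu nu : probability (borel_conf A) R) : \bar R :=
  ereal_inf [set \int[lambda]_z hamming R (A:=A) (conf1 z) (conf2 z)
            | lambda in couplings mu nu]%E.

Definition besicovitch_set (A : alphabetType)
    (mu : probability (borel_conf A) R)
    (V : set (probability (borel_conf A) R)) : \bar R :=
  ereal_inf [set besicovitch mu nu | nu in V].

(* Only the values of f on [0, 1] are used. *)
Definition stable (A : alphabetType) (F : {fset pattern d A}) : Prop :=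
  exists f : R -> R,
    [/\ (forall e : R, 0 <= e <= 1 -> 0 <= f e),
        (forall e e' : R, 0 <= e -> e <= e' -> e' <= 1 -> f e <= f e'),
        f 0 = 0,
        f x @[x --> within `[0, 1]%classic (nbhs (0 : R))] --> f 0 &
        forall e : R, 0 <= e <= 1 ->
          (ereal_sup [set besicovitch_set mu (invariant_measures F)
                     | mu in noisy_measures F e] <= (f e)%:E)%E].

End Measures.

Section AlmostPeriodic.
Variables (d : nat) (A : choiceType).
Local Notation Zd := 'rV[int]_d.

Definition grid_translates (p : nat) (G : set Zd) : set (set Zd) :=
  [set translate k G | k in cube p].

Definition periodic_off (p : nat) (T : set Zd) (x : conf d A) : Prop :=
  forall j v : Zd, ~ T j -> x (j + v *+ p) = x j.

Definition almost_periodic (R : realType) (F : {fset pattern d A})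
    (p : nat) (rho : R) (G : set Zd) : Prop :=
  [/\ periodic_set p G, (density R G <= rho%:E)%E &
      forall x, SFT F x ->
        exists! T, grid_translates p G T /\ periodic_off p T x].

(* [None] is the blank symbol. *)
Definition blank (T : set Zd) (x : conf d A) : conf d (option A) :=
  fun j => if j \in T then None else Some (x j).

(* Under [almost_periodic], the translate T is determined by x. *)
Definition blank_SFT (F : {fset pattern d A}) (p : nat) (G : set Zd) :
    set (conf d (option A)) :=
  [set y | exists x T, [/\ SFT F x, grid_translates p G T,
                           periodic_off p T x & y = blank T x]].

Definition central_translate (F : {fset pattern d A}) (p : nat) (G : set Zd)
    (x : conf d A) (T : set Zd) : Prop :=
  grid_translates p G T /\
  globally_admissible (blank_SFT F p G) (box (uphalf p)) (blank T x).

(* The last clause says that the position of the translate relative to a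
   p-square of the central window is a function of the pattern seen in that
   square, wherever the square lies in the window. *)
Definition reconstruction (F : {fset pattern d A}) (p C : nat)
    (G : set Zd) : Prop :=
  let tiling x := locally_admissible F (box (uphalf p + C)) x in
  (forall x, tiling x -> exists! T, central_translate F p G x T) /\
  (forall x x' T T' a a', tiling x -> tiling x' ->
     central_translate F p G x T -> central_translate F p G x' T' ->
     translate a (cube p) `<=` box (uphalf p) ->
     translate a' (cube p) `<=` box (uphalf p) ->
     (forall u, cube p u -> x (a + u) = x' (a' + u)) ->
     translate (- a) T = translate (- a') T').

End AlmostPeriodic.

(* Main.v *)
Require Import Defs.
From HB Require Import structures.
From mathcomp Require Import all_boot all_order all_algebra finmap.
From mathcomp Require Import all_classical all_reals all_analysis.
From mathcomp Require Import measurable_realfun zify ring lra.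

Set Implicit Arguments.
Unset Strict Implicit.
Unset Printing Implicit Defensive.

Import Order.TTheory GRing.Theory Num.Theory.
Import numFieldNormedType.Exports.

Local Open Scope classical_set_scope.
Local Open Scope ring_scope.

(** Stability holds because the phase of a noisy configuration percolates.

    Fix one of the triples [(p, rho, C)]. Around a site whose window of radius
    [uphalf p + C] is free of noise, the reconstruction property reads off a phase:
    a [p]-periodic configuration with blanks on a translate of the grid. Phases
    at neighbouring such sites coincide ([phase_overlap]), hence so do the phases
    at any two sites joined by a path of clear windows. In dimension at least two
    and for a small noise level [e], two given sites are joined in this way with
    probability [1 - O(e)], uniformly in the sites. This is shown without any
    planar topology by a hierarchy of cells: a cell of side [3 ^ j] blocks is bad
    when two of its [3 ^ d] subcells are, good neighbouring cells carry the same
    value ([coherent_coarse]), and the probability of being bad is roughly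
    squared from each level to the next ([percolation]).

    Therefore, if [om] is an element of the subshift that completes the phase at
    the origin, a noisy configuration [x] satisfies [x k <> om k] with probability
    [O(e)] at each site [k] off the grid, and the grid has density at most [rho]
    ([noisy_close]). The pair [(x, om)] is not invariant in law, as the origin is
    distinguished and as the completion of the blanks is an arbitrary choice.
    Averaging its law over translations in large cubes and passing to the limit
    yields an invariant coupling of the law of [x] with an invariant measure on
    the subshift, which charges [x 0 <> y 0] with mass at most
    [delta = O(e) + O(rho)] ([limit_coupling]). The limit is taken on
    cylinders, and extended by compactness ([cylinder_extension]).

    The Besicovitch distance involves the integral of a limsup of frequencies of
    discrepancies. A maximal inequality, from Vitali's covering argument, bounds
    it by [t + 4 ^ d * delta / t] for every [t > 0] ([hamming_integral_le]). For a
    given accuracy, one chooses [t], next a triple with [rho] small, and then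
    [e] small in terms of this triple; the supremum over noise levels at most
    [e] is thus a modulus of stability. *)

(** * Cylinder sets *)

Definition agree (d : nat) (T : Type) (J : {fset 'rV[int]_d}) (x y : conf d T) :=
  forall j, j \in J -> x j = y j.

Definition cylinder (d : nat) (T : Type) : set (set (conf d T)) :=
  [set C | exists J : {fset 'rV[int]_d}, forall x y, agree J x y -> C x -> C y].

Section CylinderAlgebra.
Variables (d : nat) (T : Type).
Local Notation Zd := 'rV[int]_d.
Implicit Types (J : {fset Zd}) (x y : conf d T).

Lemma agree_sym J x y : agree J x y -> agree J y x.
Proof. by move=> xy j jJ; rewrite xy. Qed.

Lemma agreeU J J' x y : agree (J `|` J')%fset x y -> agree J x y /\ agree J' x y.
Proof. by move=> xy; split=> j jJ; apply: xy; rewrite inE jJ ?orbT. Qed.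

Lemma cylinder0 : cylinder (@set0 (conf d T)).
Proof. by exists fset0. Qed.

Lemma cylinderC (C : set (conf d T)) : cylinder C -> cylinder (~` C).
Proof. by move=> [J JC]; exists J => x y xy nCx Cy; exact/nCx/(JC y)/Cy/agree_sym. Qed.

Lemma cylinderU (C C' : set (conf d T)) :
  cylinder C -> cylinder C' -> cylinder (C `|` C').
Proof.
move=> [J JC] [J' JC']; exists (J `|` J')%fset => x y /agreeU [xy xy'].
by case=> [/(JC _ _ xy)|/(JC' _ _ xy')]; [left|right].
Qed.

Lemma cylinderI (C C' : set (conf d T)) :
  cylinder C -> cylinder C' -> cylinder (C `&` C').
Proof.
move=> cC cC'; rewrite -(setCK (_ `&` _)) setCI.
by apply/cylinderC/cylinderU; exact: cylinderC.
Qed.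

Lemma cylinderT : cylinder (@setT (conf d T)).
Proof. by exists fset0. Qed.

End CylinderAlgebra.

Section BorelCylinder.
Variables (d : nat) (A : alphabetType).
Local Notation Zd := 'rV[int]_d.
Local Notation Tconf := (prod_topology (fun _ : Zd => discrete_topology A)).
Implicit Types (J : {fset Zd}) (x y : conf d A).

Lemma near_agree J (x : Tconf) : \forall y \near x, agree J (x : conf d A) y.
Proof.
have FF : Filter (nbhs x) by exact: nbhs_filter.
suff H (s : seq Zd) : \forall y \near x, forall j, j \in s -> x j = y j.
  exact: H J.
elim: s => [|k s IH]; first exact: filterE.
have xk : \forall y \near x, y k = x k.
  have /(_ [set x k]) := @proj_continuous Zd (fun=> discrete_topology A) k x.
  by apply; apply: (@discrete_set1 (discrete_topology A)).
apply: filterS2 xk IH => y yk IH j.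
by rewrite inE => /orP[/eqP->|]; [rewrite yk|exact: IH].
Qed.

Lemma cylinder_open (C : set Tconf) : cylinder (C : set (conf d A)) -> open C.
Proof.
move=> [J JC]; rewrite openE => x Cx; rewrite /interior.
have FF : Filter (nbhs x) by exact: nbhs_filter.
by apply: filterS (near_agree J x) => y /JC; exact.
Qed.

(** The sets containing a cylinder around [x] form a filter, which converges to
    [x] coordinatewise, hence in the product topology. *)
Lemma nbhs_cylinder (U : set Tconf) (x : Tconf) :
  nbhs x U -> exists J, forall y, agree J (x : conf d A) y -> U y.
Proof.
pose B : set_system Tconf :=
  [set V | exists J, forall y, agree J (x : conf d A) y -> V y].
have FB : Filter B.
  split; first by exists fset0.
    move=> V W [J JV] [J' JW]; exists (J `|` J')%fset => y /agreeU[? ?].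
    by split; [exact: JV|exact: JW].
  by move=> V W VW [J JV]; exists J => y /JV/VW.
suff : B --> x by apply.
apply/cvg_sup => i.
have rT : range (fun f : Tconf => f i) = setT.
  by rewrite -subTset => a _; exists (fun=> a).
apply/cvg_image => // W /(@nbhs_singleton (discrete_topology A)) Wx.
exists [set y | W (y i)].
  by exists [fset i]%fset => y /(_ i) xy; rewrite /= -xy// inE.
by rewrite predeqE => a; split=> [[y Wy <-]//|Wa]; exists (fun=> a).
Qed.

(** Only countably many cylinders fix a finite pattern, and an open set is the
    union of those that it contains. *)
Lemma measurable_borelE : @measurable _ (borel_conf d A) = <<s @cylinder d A >>.
Proof.
rewrite predeqE => U; split; apply: smallest_sub => //.
- move=> /= V oV.
  (* The cylinder of the pattern [w]; enumerating the patterns makes the union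
     countable. *)
  pose c (w : pattern d A) : set (conf d A) :=
    [set y | agree (domf w) y (fun j => odflt point (w.[? j]%fmap))].
  pose F (n : nat) : set (conf d A) :=
    if @choice.unpickle (pattern d A) n is Some w then
      if `[< c w `<=` (V : set (conf d A)) >] then c w else set0 else set0.
  have -> : V = \bigcup_n F n.
    rewrite predeqE => x; split=> [Vx|[n _]]; last first.
      by rewrite /F; case: choice.unpickle => // w; case: asboolP => // + ?; apply.
    have [J JV] : exists J, forall y, agree J (x : conf d A) y -> V y.
      by apply: nbhs_cylinder; exact: open_nbhs_nbhs.
    pose w : pattern d A := [fmap j : J => x (val j)]%fmap.
    have wE j : j \in J -> odflt point (w.[? j]%fmap) = x j.
      by move=> jJ; rewrite in_fnd ffunE.
    exists (choice.pickle w) => //; rewrite /F choice.pickleK.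
    have cV : c w `<=` V by move=> y cy; apply: JV => j jJ; rewrite cy ?wE.
    by rewrite asboolT// => j jJ; rewrite wE.
  apply: sigma_algebra_bigcup.
  move=> n; rewrite /F; case: choice.unpickle => [w|]; last exact: sigma_algebra0.
    case: ifP => _; last exact: sigma_algebra0.
    apply: sub_sigma_algebra; exists (domf w) => y z yz cy j jw.
    by rewrite -yz// cy.
- exact: sigma_algebra_measurable.
- by move=> V cV; apply: sub_sigma_algebra; exact: cylinder_open.
Qed.

Lemma cylinder_measurable (C : set (borel_conf d A)) :
  cylinder (C : set (conf d A)) -> measurable C.
Proof. by move=> cC; apply: sub_sigma_algebra; exact: cylinder_open. Qed.

Lemma probability_cylinder_unique (R : realType)
    (mu nu : probability (borel_conf d A) R) :
  (forall C, cylinder (C : set (conf d A)) -> mu C = nu C) ->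
  forall B, measurable B -> mu B = nu B.
Proof.
move=> munu.
apply: (@measure_unique _ R (borel_conf d A) (@cylinder d A) (fun=> setT)) => //.
- exact: measurable_borelE.
- by move=> C C'; exact: cylinderI.
- by move=> _; exact: cylinderT.
- by rewrite bigcup_const.
- by move=> _; rewrite -ge0_fin_numE// fin_num_measure.
Qed.

Lemma measurable_fun_cylinder (B : alphabetType) (f : borel_conf d B -> borel_conf d A) :
  (forall C, cylinder (C : set (conf d A)) -> measurable (f @^-1` C)) ->
  measurable_fun setT f.
Proof.
move=> fC.
apply: (@measurability _ _ (borel_conf d B) (borel_conf d A) setT f (@cylinder d A)).
  exact: measurable_borelE.
by move=> _ [C cC <-]; rewrite setTI; exact: fC.
Qed.

Lemma cylinder_compact (C : set Tconf) : cylinder (C : set (conf d A)) -> compact C.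
Proof.
move=> cC.
have cT : compact [set: Tconf].
  rewrite (_ : setT = [set f : Tconf | forall i, setT (f i)]).
    apply: (@tychonoff Zd (fun=> discrete_topology A) (fun=> setT)) => _.
    apply: (@finite_compact (discrete_topology A)).
    by have : finite_set [set: A] by exact: finite_finset.
  by apply/esym; rewrite -subTset.
apply: (subclosed_compact _ cT) => //.
by rewrite -(setCK C); apply/open_closedC/cylinder_open/cylinderC.
Qed.

(** If no finite subfamily covers [C], what the finite subfamilies leave of [C]
    generates a proper filter; by Tychonoff it has a cluster point in [C], which
    none of the [F n] contains. *)
Lemma cylinder_subcover (C : set (conf d A)) (F : nat -> set (conf d A)) :
  cylinder C -> (forall n, cylinder (F n)) -> C `<=` \bigcup_n F n ->
  exists N, C `<=` \bigcup_(k < N) F k.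
Proof.
move=> cC cF CF; apply: contrapT => noN.
pose E n : set Tconf := C `\` \bigcup_(k < n) F k.
have EI n n' : E (maxn n n') `<=` E n `&` E n'.
  move=> x [Cx nFx]; split; split=> // -[k /= kn Fx]; apply: nFx; exists k => //=;
  by rewrite (leq_trans kn) ?leq_maxl ?leq_maxr.
pose H : set_system Tconf := [set V | exists n, E n `<=` V].
have PH : ProperFilter H.
  split.
    move=> [n En]; apply: noN; exists n => x Cx.
    by apply: contrapT => nFx; apply: (En x).
  split; first by exists 0%N.
    move=> V W [n EV] [n' EW]; exists (maxn n n') => x /EI[/EV ? /EW ?]; by split.
  by move=> V W VW [n EV]; exists n => x /EV/VW.
have [|x [Cx clx]] := cylinder_compact cC PH; first by exists 0%N => x [].
have [k _ Fkx] := CF x Cx.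
have [||y [[_ nFy] Fy]] := clx (E k.+1) (F k); first by exists k.+1.
  by apply: open_nbhs_nbhs; split => //; exact/cylinder_open/cF.
by apply: nFy; exists k => /=.
Qed.

End BorelCylinder.

(** * Extension of finitely additive probabilities *)

(** A copy of the space of configurations that carries the algebra of cylinders
    only, as Caratheodory's extension starts from an algebra of sets. *)
Definition cylinder_space (d : nat) (A : alphabetType) : Type := conf d A.

HB.instance Definition _ (d : nat) (A : alphabetType) :=
  Pointed.on (cylinder_space d A).

HB.instance Definition _ (d : nat) (A : alphabetType) :=
  @isAlgebraOfSets.Build default_measure_display (cylinder_space d A)
    (@cylinder d A) (@cylinder0 d A) (@cylinderU d A) (@cylinderC d A).

Section Extension.
Variables (R : realType) (d : nat) (A : alphabetType).
Variable m : set (conf d A) -> R.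
Hypothesis m_ge0 : forall C, 0 <= m C.
Hypothesis m_setT : m setT = 1.
Hypothesis m_additive : forall C C', cylinder C -> cylinder C' ->
  C `&` C' = set0 -> m (C `|` C') = m C + m C'.

Let content (C : set (cylinder_space d A)) : \bar R := (m C)%:E.

Let m_set0 : m set0 = 0.
Proof.
have /= := m_additive (@cylinder0 d A) (@cylinder0 d A) (set0I _).
by rewrite setU0 => /eqP; rewrite addrC -subr_eq subrr => /eqP.
Qed.

Let content_ge0 (C : set (cylinder_space d A)) : (0 <= content C)%E.
Proof. by rewrite lee_fin. Qed.

Let content_semi_additive : measure_function.semi_additive content.
Proof.
move=> F n Fm Ftriv _; rewrite /content.
elim: n => [|n IH]; first by rewrite !big_ord0 m_set0.
have cF k : cylinder (\big[setU/set0]_(i < k) F i).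
  by apply: (@bigsetU_measurable _ (cylinder_space d A)).
rewrite !big_ord_recr/= m_additive ?EFinD ?IH//; [exact: cF|exact: Fm|].
rewrite -bigcup_mkord -subset0 => x [[k /= kn Fkx] Fnx].
have kEn : k = n by apply: (Ftriv k n) => //; exists x.
by rewrite kEn ltnn in kn.
Qed.

HB.instance Definition _ := @isContent.Build _ (cylinder_space d A) R content
  content_ge0 content_semi_additive.

Let content_sigma_subadditive : measurable_subset_sigma_subadditive content.
Proof.
move=> C F cF cC CF.
have [N CN] := cylinder_subcover cC cF CF.
apply: (@le_trans _ _ (\sum_(k < N) content (F k))).
  by apply: content_subadditive; rewrite // -bigcup_mkord.
rewrite -(big_mkord xpredT (fun k => content (F k))).
by apply: nneseries_lim_ge.
Qed.

HB.instance Definition _ := Content_SigmaSubAdditive_isMeasure.Build _ R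
  (cylinder_space d A) content content_sigma_subadditive.

Let P (B : set (borel_conf d A)) : \bar R := measure_extension content B.

Let borel_ext (B : set (borel_conf d A)) : measurable B ->
  <<s @measurable _ (cylinder_space d A) >> B.
Proof. by rewrite measurable_borelE. Qed.

Let P0 : P set0 = 0%E.
Proof. exact: measure0. Qed.

Let P_ge0 B : (0 <= P B)%E.
Proof. exact: measure_ge0. Qed.

Let P_sigma_additive : semi_sigma_additive P.
Proof.
move=> F Fm Ftriv FUm; apply: (@measure_semi_sigma_additive _
  (g_sigma_algebraType (@measurable _ (cylinder_space d A))) R
  (measure_extension content)) => //; last exact: borel_ext.
by move=> i; have := borel_ext (Fm i).
Qed.

HB.instance Definition _ := isMeasure.Build _ _ _ P P0 P_ge0 P_sigma_additive.

Let P_cylinder C : cylinder C -> P C = (m C)%:E.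
Proof. by move=> cC; rewrite /P /measure_extension measurable_mu_extE. Qed.

Let P_setT : P setT = 1%E.
Proof. by rewrite P_cylinder ?m_setT//; exact: cylinderT. Qed.

HB.instance Definition _ := Measure_isProbability.Build _ _ _ P P_setT.

(** By compactness a cylinder covered by countably many cylinders is covered by
    finitely many of them, so that finite additivity is enough for the
    Caratheodory extension. *)
Lemma cylinder_extension : exists P : probability (borel_conf d A) R,
  forall C, cylinder C -> P C = (m C)%:E.
Proof. by exists P. Qed.

End Extension.

(** * Cubes of the lattice *)

Section Coordinates.
Variable d : nat.
Implicit Types (k v : 'rV[int]_d) (i : 'I_d).

Lemma coordD k v i : (k + v) 0 i = k 0 i + v 0 i.
Proof. by rewrite mxE. Qed.

Lemma coordN k i : (- k) 0 i = - k 0 i.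
Proof. by rewrite mxE. Qed.

Lemma coord0 i : (0 : 'rV[int]_d) 0 i = 0.
Proof. by rewrite mxE. Qed.

Lemma coordMn k n i : (k *+ n) 0 i = k 0 i * n%:Z.
Proof.
elim: n => [|n IH]; first by rewrite mulr0n coord0 mulr0.
by rewrite mulrS coordD IH; lia.
Qed.

Lemma coord_const (a : int) i : (const_mx a : 'rV[int]_d) 0 i = a.
Proof. by rewrite mxE. Qed.

Lemma coord_delta i j : (delta_mx 0 i : 'rV[int]_d) 0 j = (j == i)%:Z.
Proof. by rewrite mxE eqxx natz. Qed.

(** All the right-hand sides are syntactically of type [int], which identifies equal
    entries in linear arithmetic. *)
Definition coordE := (coordD, coordN, coord0, coordMn, coord_const, coord_delta).

End Coordinates.

Section Boxes.
Variable d : nat.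
Local Notation Zd := 'rV[int]_d.
Implicit Types (k v lo : Zd).

Definition fbox (lo : Zd) (n : nat) : {fset Zd} :=
  [fset (lo + \row_i (u i : nat)%:Z)%R | u : {ffun 'I_d -> 'I_n} in predT]%fset.

Lemma in_fbox lo n k :
  reflect (forall i, lo 0 i <= k 0 i < lo 0 i + n%:Z) (k \in fbox lo n).
Proof.
apply: (iffP idP) => [/imfsetP[u _ ->] i|H].
  by rewrite !mxE lerDl ltrD2l ltz_nat ltn_ord lez_nat.
have Hn i : (absz (k 0 i - lo 0 i)%R < n)%N.
  have /andP[lk kl] := H i; rewrite -ltz_nat gez0_abs ?subr_ge0//.
  by rewrite ltrBlDl.
apply/imfsetP; exists [ffun i => Ordinal (Hn i)] => //=.
apply/rowP => i; rewrite !mxE ffunE/= gez0_abs ?subrKC//.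
by rewrite subr_ge0; case/andP: (H i).
Qed.

Lemma card_fbox lo n : #|` fbox lo n| = (n ^ d)%N.
Proof.
rewrite card_imfset/=.
  by rewrite -cardT card_ffun !card_ord.
move=> u u' /addrI/rowP E; apply/ffunP => i; apply/val_inj.
by have := E i; rewrite !mxE => -[].
Qed.

Lemma mem_fboxD lo n k v : (k + v \in fbox (lo + v) n) = (k \in fbox lo n).
Proof.
apply/in_fbox/in_fbox => H i; have := H i; rewrite !coordE; lia.
Qed.

Lemma fbox_sum_shift (V : nmodType) lo n v (f : Zd -> V) :
  \sum_(k <- fbox lo n) f (k + v) = \sum_(k <- fbox (lo + v) n) f k.
Proof.
have -> : fbox (lo + v) n = [fset (k + v)%R | k in fbox lo n]%fset.
  apply/fsetP => k; apply/idP/imfsetP => [kin|[k' /= k'in ->]]; last by rewrite mem_fboxD.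
  by exists (k - v); rewrite ?subrK//= -(mem_fboxD _ _ _ v) subrK.
by rewrite [RHS]big_imfset//= => x y _ _ /addIr.
Qed.

Lemma cubeE n : @cube d n = [set` fbox 0 n].
Proof.
by rewrite predeqE => k; split=> [H|/in_fbox H]; [apply/in_fbox|] => i;
  have := H i; rewrite mxE add0r.
Qed.

Lemma cubeP n k : reflect (cube n k) (k \in fbox 0 n).
Proof.
by apply: (iffP idP) => [|H]; [|change ([set` fbox 0 n] k)]; rewrite -?cubeE// cubeE.
Qed.

Lemma boxE n : @box d n = [set` fbox (const_mx (- n%:Z)) n.*2.+1].
Proof.
by rewrite predeqE => k; split=> [H|/in_fbox H]; [apply/in_fbox|] => i;
  have := H i; rewrite !coordE; lia.
Qed.

End Boxes.

(** * Local maps, real-valued probabilities and averages over cubes *)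

Section LocalMaps.
Variable d : nat.
Local Notation Zd := 'rV[int]_d.

Definition local_map (S T : Type) (f : conf d S -> conf d T) :=
  forall j, exists J : {fset Zd}, forall x y, agree J x y -> f x j = f y j.

Lemma local_map_window (S T : Type) (f : conf d S -> conf d T) (J : {fset Zd}) :
  local_map f ->
  exists J' : {fset Zd}, forall x y, agree J' x y -> agree J (f x) (f y).
Proof.
move=> fl; suff H (s : seq Zd) : exists J' : {fset Zd}, forall x y, agree J' x y ->
    forall j, j \in s -> f x j = f y j by exact: H J.
elim: s => [|k s [J1 H1]]; first by exists fset0.
have [J2 H2] := fl k; exists (J1 `|` J2)%fset => x y /agreeU[xy1 xy2] j.
by rewrite inE => /orP[/eqP->|]; [exact: H2|exact: H1].
Qed.

Lemma cylinder_preimage (S T : Type) (f : conf d S -> conf d T) C :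
  local_map f -> cylinder C -> cylinder (f @^-1` C).
Proof.
move=> fl [J JC]; have [J' H] := local_map_window J fl.
by exists J' => x y xy; apply: JC; exact: H.
Qed.

Lemma local_map_comp (S T U : Type) (f : conf d T -> conf d U) (g : conf d S -> conf d T) :
  local_map f -> local_map g -> local_map (f \o g).
Proof.
move=> fl gl j; have [J HJ] := fl j; have [J' HJ'] := local_map_window J gl.
by exists J' => x y /HJ'/HJ.
Qed.

Lemma local_map_pointwise (S T : Type) (g : S -> T) (h : Zd -> Zd) :
  local_map (fun (x : conf d S) k => g (x (h k))).
Proof. by move=> j; exists [fset h j]%fset => x y xy; rewrite xy ?inE. Qed.

Lemma local_map_shift (T : Type) k : local_map (@shift_conf d T k).
Proof. exact: (local_map_pointwise id (fun l => k + l)). Qed.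

Lemma local_map_conf1 (A B : alphabetType) : local_map (@conf1 d A B).
Proof. exact: (local_map_pointwise fst id). Qed.

Lemma local_map_conf2 (A B : alphabetType) : local_map (@conf2 d A B).
Proof. exact: (local_map_pointwise snd id). Qed.

Lemma local_measurable (A B : alphabetType) (f : borel_conf d A -> borel_conf d B) :
  local_map f -> measurable_fun setT f.
Proof.
move=> fl; apply: measurable_fun_cylinder => C cC.
by apply: cylinder_measurable; exact: cylinder_preimage.
Qed.

Lemma local_preimage (A B : alphabetType) (f : borel_conf d A -> borel_conf d B)
    (C : set (borel_conf d B)) : local_map f -> measurable C -> measurable (f @^-1` C).
Proof. by move=> /local_measurable fm mC; rewrite -[X in measurable X]setTI; exact: fm. Qed.

Lemma probability_image (R : realType) (A B : alphabetType)
    (P : probability (borel_conf d A) R) (f : borel_conf d A -> borel_conf d B) :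
  local_map f -> exists Q : probability (borel_conf d B) R,
    forall C, Q C = P (f @^-1` C).
Proof.
move=> /local_measurable fm.
have [Q QE] : exists Q : set (borel_conf d B) -> \bar R, forall C, Q C = P (f @^-1` C).
  by exists (fun C => P (f @^-1` C)).
have Q0 : Q set0 = 0%E by rewrite QE preimage_set0 measure0.
have Q_ge0 C : (0 <= Q C)%E by rewrite QE; exact: measure_ge0.
have QD : semi_sigma_additive Q.
  move=> F mF tF mUF; rewrite QE preimage_bigcup.
  rewrite (_ : (fun n => _) = (fun n => \sum_(0 <= i < n) P (f @^-1` F i))%E); last first.
    by apply/funext => n; under eq_bigr do rewrite QE.
  apply: measure_semi_sigma_additive.
  - by move=> n; rewrite -[X in measurable X]setTI; exact: fm.
  - apply/trivIsetP => /= i j _ _ ij; rewrite -preimage_setI.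
    by move/trivIsetP : tF => /(_ _ _ _ _ ij) ->//; rewrite preimage_set0.
  - by rewrite -preimage_bigcup -[X in measurable X]setTI; exact: fm.
have QT : Q setT = 1%E by rewrite QE preimage_setT probability_setT.
pose Qm := @isMeasure.Build _ (borel_conf d B) R Q Q0 Q_ge0 QD.
pose mQ : {measure set (borel_conf d B) -> \bar R} := HB.pack Q Qm.
pose Qp := Measure_isProbability.Build _ _ R mQ QT.
by exists (HB.pack_for (probability (borel_conf d B) R) Q Qm Qp).
Qed.

End LocalMaps.

Section RealProbability.
Context (R : realType) dd (T : measurableType dd).
Variable P : probability T R.
Implicit Types S : set T.

Definition rprob S : R := fine (P S).

Lemma rprobE S : measurable S -> P S = (rprob S)%:E.
Proof. by move=> mS; rewrite /rprob fineK// fin_num_measure. Qed.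

Lemma rprob_ge0 S : 0 <= rprob S.
Proof. by rewrite fine_ge0. Qed.

Lemma rprob_le1 S : measurable S -> rprob S <= 1.
Proof. by move=> mS; rewrite -lee_fin -rprobE// probability_le1. Qed.

Lemma rprob_setT : rprob setT = 1.
Proof. by rewrite /rprob probability_setT. Qed.

Lemma rprobU S S' : measurable S -> measurable S' -> S `&` S' = set0 ->
  rprob (S `|` S') = rprob S + rprob S'.
Proof.
move=> mS mS' SS'; apply: EFin_inj; rewrite EFinD -!rprobE//; last exact: measurableU.
exact: measureU.
Qed.

Lemma rprobU_le S S' : measurable S -> measurable S' ->
  rprob (S `|` S') <= rprob S + rprob S'.
Proof.
move=> mS mS'; rewrite -lee_fin EFinD -!rprobE//; last exact: measurableU.
exact: measureU2.
Qed.

Lemma rprob_mono S S' : measurable S -> measurable S' -> S `<=` S' ->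
  rprob S <= rprob S'.
Proof. by move=> mS mS' SS'; rewrite -lee_fin -!rprobE// le_measure// inE. Qed.

Lemma rprob_sum (I : eqType) (r : seq I) (S : I -> set T) :
  (forall i, i \in r -> measurable (S i)) ->
  rprob (\big[setU/set0]_(i <- r) S i) <= \sum_(i <- r) rprob (S i).
Proof.
elim: r => [|i r IH] mS; first by rewrite !big_nil /rprob measure0.
rewrite !big_cons; apply: (le_trans (rprobU_le _ _)).
- by apply: mS; rewrite mem_head.
- rewrite big_seq; elim/big_ind: _ => [//||j jr]; first exact: measurableU.
  by apply: mS; rewrite inE jr orbT.
- by rewrite lerD2l IH// => j jr; apply: mS; rewrite inE jr orbT.
Qed.

End RealProbability.

(** An ultrafilter makes all bounded sequences converge at once, which spares the
    extraction of a subsequence common to all the cylinders. *)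
Lemma ultra_cvg (R : realType) (U : set_system nat) (u : nat -> R) :
  UltraFilter U -> (forall n, 0 <= u n <= 1) -> cvg (u n @[n --> U]).
Proof.
move=> UU u01.
have [|p [_ pcl]] := @segment_compact R 0 1 (u n @[n --> U]) _.
- by rewrite /= /fmap /=; apply: filterE => n /=; rewrite in_itv/= u01.
- apply/cvg_ex; exists p => V pV.
  have [//|nV] := in_ultra_setVsetC (u @^-1` V) UU.
  by have [|x [nVx Vx]] := pcl (~` V) V _ pV; first by rewrite /= /fmap.
Qed.

(** A cube loses at most [a * N ^ d.-1] points in each of its [d] directions when
    its side is shortened by [a]. *)
Lemma expn_subn_le (N a d : nat) :
  (N ^ d <= (N - a) ^ d + d * a * N ^ d.-1)%N.
Proof.
elim: d => [//|d IH]; rewrite /=.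
have dE : (d * a * N ^ d.-1 * N = d * a * N ^ d)%N.
  by case: d {IH} => [//|d]; rewrite /= expnSr mulnA.
have h : ((N - a) ^ d <= N ^ d)%N by case: d {IH dE} => // d; rewrite leq_exp2r ?leq_subr.
have := leq_mul IH (leqnn N); rewrite -expnSr mulnDl dE => /leq_trans; apply.
rewrite mulSn mulnDl addnA leq_add2r expnSr -leq_subLR -mulnBr mulnC.
by rewrite leq_mul//; lia.
Qed.

Section Folner.
Context (R : realType) (d : nat).
Local Notation Zd := 'rV[int]_d.

Lemma sum_subset_bounds (S I : {fset Zd}) (f : Zd -> R) :
  (I `<=` S)%fset -> (forall k, 0 <= f k <= 1) ->
  \sum_(k <- I) f k <= \sum_(k <- S) f k <= \sum_(k <- I) f k + (#|` S|%:R - #|` I|%:R).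
Proof.
move=> IS f01; rewrite (big_fsetID _ (mem I) S)/=.
have -> : [fset x in S | x \in I]%fset = I.
  apply/fsetP => k; rewrite !inE/=; apply/andP/idP => [[]//|kI].
  by split => //; exact: (fsubsetP IS).
have -> : [fset x in S | x \notin I]%fset = (S `\` I)%fset.
  by apply/fsetP => k; rewrite !inE/= andbC.
rewrite lerDl lerD2l sumr_ge0/=; last by move=> k _; case/andP: (f01 k).
have -> : #|` S|%:R - #|` I|%:R = \sum_(k <- (S `\` I)%fset) (1 : R).
  rewrite big_const_seq count_predT iter_addr_0 cardfsD (fsetIidPr IS) natrB//.
  exact: fsubset_leq_card.
by apply: ler_sum => k _; case/andP: (f01 k).
Qed.

(** Cubes are asymptotically invariant: a cube of side [N] and its translate
    by [v] share a cube of side [N - 2M], where [M] bounds the entries of [v]. *)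
Lemma folner_bound (v : Zd) : exists M : nat, forall (N : nat) (f : Zd -> R),
  (forall k, 0 <= f k <= 1) ->
  `|\sum_(k <- fbox 0 N) f (k + v) - \sum_(k <- fbox 0 N) f k| <=
  (d * M * N ^ d.-1)%:R.
Proof.
pose M := \max_(i < d) absz (v 0%R i).
have vM i : (absz (v 0%R i) <= M)%N by exact: leq_bigmax.
exists (2 * M)%N => N f f01; rewrite fbox_sum_shift add0r.
pose I : {fset Zd} := fbox (const_mx M%:Z) (N - 2 * M).
have I1 : (I `<=` fbox v N)%fset.
  apply/fsubsetP => k /in_fbox H; apply/in_fbox => i; have := H i; have := vM i.
  by rewrite !coordE; lia.
have I2 : (I `<=` fbox 0 N)%fset.
  apply/fsubsetP => k /in_fbox H; apply/in_fbox => i; have := H i; have := vM i.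
  by rewrite !coordE; lia.
have := sum_subset_bounds I1 f01; have := sum_subset_bounds I2 f01.
rewrite !card_fbox => /andP[l1 u1] /andP[l2 u2].
have : (N ^ d)%:R <= ((N - 2 * M) ^ d)%:R + (d * (2 * M) * N ^ d.-1)%:R :> R.
  by rewrite -natrD ler_nat expn_subn_le.
by move=> H; rewrite ler_norml; lra.
Qed.

End Folner.

(** * Invariant couplings as limits of averages *)

Section FullMeasure.
Context (R : realType) (d : nat) (A : alphabetType).
Variable F : {fset pattern d A}.
Local Notation Zd := 'rV[int]_d.

Lemma cylinder_matches (w : pattern d A) (k : Zd) :
  cylinder [set x : conf d A | matches w (shift_conf k x)].
Proof.
exists [fset (k + i)%R | i in domf w]%fset => x y xy mx i iw.
by rewrite (mx i iw) /shift_conf xy//; apply/imfsetP; exists i.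
Qed.

Let clash (n : nat) : set (borel_conf d A) :=
  if @choice.unpickle (pattern d A * Zd)%type n is Some (w, k) then
    if w \in F then [set x | matches w (shift_conf k x)] else set0
  else set0.

Let SFTE : SFT F = ~` \bigcup_n clash n.
Proof.
rewrite predeqE => x; split.
  move=> xF [n _]; rewrite /clash; case: choice.unpickle => // -[w k].
  by case: ifP => // wF; exact: xF.
move=> nx w k wF mx; apply: nx; exists (choice.pickle (w, k)) => //.
by rewrite /clash choice.pickleK wF.
Qed.

Let clash_measurable n : measurable (clash n).
Proof.
rewrite /clash; case: choice.unpickle => [[w k]|//]; case: ifP => // _.
apply: cylinder_measurable; exact: cylinder_matches.
Qed.

Lemma SFT_measurable : measurable (SFT F : set (borel_conf d A)).
Proof. by rewrite SFTE; apply: measurableC; exact: bigcup_measurable. Qed.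

(** The complement of the subshift is a countable union of translated
    cylinders. *)
Lemma SFT_full (Q : probability (borel_conf d A) R) :
  (forall w k, w \in F -> Q [set x | matches w (shift_conf k x)] = 0%E) ->
  Q (SFT F) = 1%E.
Proof.
move=> Q0.
have U0 : Q (\bigcup_n clash n) = 0%E.
  have : Q.-negligible (\bigcup_n clash n).
    apply: negligible_bigcup => n; apply/negligibleP => //.
    rewrite /clash; case: choice.unpickle => [[w k]|]; last exact: measure0.
    by case: ifP => [wF|_]; [exact: Q0|exact: measure0].
  by move=> /negligibleP; apply; exact: bigcup_measurable.
by rewrite SFTE probability_setC ?U0 ?sube0//; exact: bigcup_measurable.
Qed.

End FullMeasure.

Section LimitCoupling.
Context (R : realType) (d : nat) (A : alphabetType).
Variable F : {fset pattern d A}.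
Local Notation Zd := 'rV[int]_d.
Local Notation noisy := (borel_conf d (A * bool)%type).
Variables (lam : probability noisy R) (mu : probability (borel_conf d A) R).
Variables (om : conf d (A * bool) -> conf d A) (delta : R).
Hypothesis lam_inv : shift_invariant lam.
Hypothesis lam_mu : same_measure (pushforward lam (@conf1 d A bool)) mu.
Hypothesis om_SFT : forall z, SFT F (om z).
Hypothesis om_local : local_map om.
Hypothesis om_close : exists N0, forall N, (N0 <= N)%N ->
  \sum_(k <- fbox 0 N) rprob lam [set z | (z k).1 <> om z k] <= delta * (N ^ d)%:R.

Let pair (z : conf d (A * bool)) : conf d (A * A) := fun k => ((z k).1, om z k).

Let P (k : Zd) (C : set (conf d (A * A))) : R :=
  rprob lam ((fun z => shift_conf k (pair z)) @^-1` C).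

Let avg (C : set (conf d (A * A))) (N : nat) : R :=
  (\sum_(k <- fbox 0 N) P k C) / (N ^ d)%:R.

Let pair_local : local_map pair.
Proof.
move=> j; have [J HJ] := om_local j; exists (J `|` [fset j])%fset => x y.
by move=> /agreeU[/HJ oj /(_ j)]; rewrite /pair inE eqxx oj => ->.
Qed.

Let P_measurable k C : cylinder C ->
  measurable ((fun z => shift_conf k (pair z)) @^-1` C : set noisy).
Proof.
move=> cC; apply: cylinder_measurable.
apply: (@cylinder_preimage _ _ _ (fun z => shift_conf k (pair z))) cC.
exact: (local_map_comp (@local_map_shift d _ k) pair_local).
Qed.

Let P01 k C : cylinder C -> 0 <= P k C <= 1.
Proof. by move=> cC; rewrite rprob_ge0 rprob_le1//; exact: P_measurable. Qed.

Let sum_const (c : R) N : \sum_(k <- @fbox d 0 N) c = c * (N ^ d)%:R.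
Proof. by rewrite big_const_seq count_predT iter_addr_0 card_fbox mulr_natr. Qed.

Let avg01 C N : cylinder C -> 0 <= avg C N <= 1.
Proof.
move=> cC; rewrite /avg divr_ge0//=; last by apply: sumr_ge0 => k _; exact: rprob_ge0.
have le : \sum_(k <- fbox 0 N) P k C <= (N ^ d)%:R.
  rewrite -[leRHS]mul1r -sum_const; apply: ler_sum => k _.
  by case/andP: (P01 k cC).
have [->|N0] := eqVneq (N ^ d)%N 0%N; first by rewrite invr0 mulr0 ler01.
by rewrite ler_pdivrMr ?mul1r// ltr0n lt0n.
Qed.

Let avg_const C N (c : R) : (0 < N)%N -> (forall k, P k C = c) -> avg C N = c.
Proof.
move=> N0 Pc; rewrite /avg (eq_bigr (fun=> c)) ?sum_const; last by move=> k _.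
by rewrite mulfK// pnatr_eq0 -lt0n expn_gt0 N0.
Qed.

(** The coupling is a limit, along an ultrafilter, of the averages over large
    cubes of the translates of the law of [(x, om)]; averaging over cubes makes
    the limit invariant, although [om] does not commute with the shifts. *)
Lemma limit_coupling : exists nu : probability (borel_conf d A) R,
  invariant_measures F nu /\ exists Lam : probability (borel_conf d (A * A)%type) R,
    couplings mu nu Lam /\
    (Lam [set z : conf d (A * A) | (z 0%R).1 <> (z 0%R).2] <= delta%:E)%E.
Proof.
have [U [UU ooU]] := @ultraFilterLemma nat \oo _.
have near1 : \forall N \near U, (0 < N)%N by apply: ooU; exists 1%N.
(* The value off the cylinders only has to be nonnegative. *)
pose m C : R := if `[< cylinder C >] then lim (avg C N @[N --> U]) else 0.
have mE C : cylinder C -> avg C N @[N --> U] --> m C.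
  by move=> cC; rewrite /m asboolT//; apply: ultra_cvg => // N; exact: avg01.
have m_ge0 C : 0 <= m C.
  rewrite /m; case: ifPn => // /asboolP cC; apply: limr_ge.
    by apply: ultra_cvg => // N; exact: avg01.
  by apply: filterE => N; case/andP: (avg01 N cC).
have m_le C c : cylinder C -> (\forall N \near U, avg C N <= c) -> m C <= c.
  move=> cC le; have := mE _ cC; move=> /cvg_lim <-//; apply: limr_le => //.
  by apply: ultra_cvg => // N; exact: avg01.
have m_const C c : cylinder C -> (forall k, P k C = c) -> m C = c.
  move=> cC Pc; have := mE _ cC; move=> /cvg_lim <-//; apply: cvg_lim => //.
  by apply: cvg_near_cst; apply: filterS near1 => N N0; exact: avg_const.
have m_setT : m setT = 1.
  by apply: m_const => [|k]; [exact: cylinderT|rewrite /P preimage_setT rprob_setT].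
have m_add C C' : cylinder C -> cylinder C' -> C `&` C' = set0 ->
    m (C `|` C') = m C + m C'.
  move=> cC cC' CC'; have := mE _ (cylinderU cC cC') => /cvg_lim <-//.
  apply: cvg_lim => //; rewrite (_ : avg (C `|` C') = avg C \+ avg C').
    by apply: cvgD; exact: mE.
  apply/funext => N; rewrite /= /avg -mulrDl -big_split/=; congr (_ / _).
  apply: eq_bigr => k _; rewrite /P preimage_setU rprobU//.
  - exact: P_measurable.
  - exact: P_measurable.
  - by rewrite -preimage_setI CC' preimage_set0.
have [Lam LamE] := cylinder_extension m_ge0 m_setT m_add.
have Lam_inv : shift_invariant Lam.
  move=> v B mB; have [Q QE] := probability_image Lam (@local_map_shift d (A * A)%type v).
  rewrite -QE; apply: probability_cylinder_unique B mB.
  move=> C cC; rewrite QE !LamE//; last exact: (cylinder_preimage (@local_map_shift d _ v)).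
  congr EFin; apply/eqP; rewrite -subr_eq0; apply/eqP.
  set C' := _ @^-1` C.
  have cC' : cylinder C' by exact: (cylinder_preimage (@local_map_shift d _ v)).
  have <- : lim ((avg C' N - avg C N) @[N --> U]) = m C' - m C.
    by apply: cvg_lim => //; apply: cvgB; exact: mE.
  apply: cvg_lim => //.
  have PC' k : P k C' = P (k + v) C.
    congr (rprob lam _); apply/funext => z; rewrite /C' /preimage/=; congr C.
    by apply/funext => l; rewrite /shift_conf addrA.
  (* The averages over a cube and over its translate by [v] differ by a boundary
     term, of the order of [N ^ d.-1]. *)
  have [M HM] := @folner_bound R d v.
  suff H : (avg C' N - avg C N) @[N --> \oo] --> (0 : R).
    by apply: cvg_trans H => V HV; exact: ooU.
  apply/cvgrPdist_le => e e0; near=> N; rewrite sub0r normrN.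
  have N0 : (0 < N)%N by near: N; exists 1%N.
  rewrite /avg -mulrBl normrM [X in _ * X]ger0_norm ?invr_ge0//.
  rewrite ler_pdivrMr; last by rewrite ltr0n expn_gt0 N0.
  under eq_bigr do rewrite PC'.
  apply: le_trans (HM N (P^~ C) _) _; first by move=> k; exact: P01.
  have dN : (d * M * N ^ d.-1 * N <= d * M * N ^ d)%N.
    by case: (d) => [//|d'] /=; rewrite [in leqRHS]expnSr mulnA.
  have -> : e * (N ^ d)%:R = e * N%:R * (N ^ d)%:R / N%:R.
    by field; rewrite pnatr_eq0 -lt0n.
  rewrite ler_pdivlMr ?ltr0n// -natrM.
  apply: (@le_trans _ _ (d * M * N ^ d)%:R); first by rewrite ler_nat.
  rewrite natrM ler_wpM2r//; near: N.
  apply: filterS (nbhs_infty_ger ((d * M)%:R / e)) => N.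
  by rewrite ler_pdivrMr// mulrC.
have [Q1 Q1E] := probability_image Lam (@local_map_conf1 d A A).
have [nu nuE] := probability_image Lam (@local_map_conf2 d A A).
have nu_inv : shift_invariant nu.
  move=> k B mB; rewrite !nuE -[RHS](Lam_inv k)//.
  exact: (local_preimage (@local_map_conf2 d A A)).
exists nu; split.
  split => //; apply: SFT_full => w k wF; rewrite nuE LamE; last first.
    exact: (cylinder_preimage (@local_map_conf2 d A A) (cylinder_matches _ _)).
  congr EFin; apply: m_const => [|k'].
    exact: (cylinder_preimage (@local_map_conf2 d A A) (cylinder_matches _ _)).
  rewrite /P (_ : _ @^-1` _ = set0) /rprob ?measure0// -subset0 => z /= mz.
  apply: (om_SFT (z := z) (w := w) (k := k' + k) wF) => i iw.
  by rewrite (mz i iw) /conf2 /shift_conf addrA.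
exists Lam; split.
  split; [exact: Lam_inv| |by move=> B _; rewrite nuE].
  move=> B mB; have -> : pushforward Lam (@conf1 d A A) B = Q1 B by rewrite Q1E.
  apply: probability_cylinder_unique B mB.
  move=> C cC; rewrite Q1E LamE; last exact: (cylinder_preimage (@local_map_conf1 d A A)).
  have mC : measurable (C : set (borel_conf d A)) by exact: cylinder_measurable.
  rewrite (@rprobE R _ _ mu)//; congr EFin; apply: m_const => [|k].
    exact: (cylinder_preimage (@local_map_conf1 d A A)).
  rewrite /P /rprob -(lam_mu mC) /pushforward -[in RHS](lam_inv k)//.
  exact: (local_preimage (@local_map_conf1 d A bool)).
have cD : cylinder [set z : conf d (A * A)%type | (z 0).1 <> (z 0).2].
  by exists [fset (0 : Zd)]%fset => x y xy /=; rewrite -xy// inE.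
rewrite LamE// lee_fin; apply: m_le => //.
have [N0 HN0] := om_close.
apply: ooU; exists (maxn 1 N0) => // N /=; rewrite geq_max => /andP[N1 /HN0 le].
rewrite /avg ler_pdivrMr; last by rewrite ltr0n expn_gt0 N1.
apply: le_trans le; rewrite le_eqVlt; apply/orP; left; apply/eqP.
apply: eq_bigr => k _; congr (rprob lam _); apply/funext => z /=.
by rewrite /shift_conf /pair addr0.
Unshelve. all: by end_near. Qed.

End LimitCoupling.

(** * The maximal inequality *)

Section Maximal.
Context (R : realType) (d : nat).
Local Notation Zd := 'rV[int]_d.

Definition ball_at (a : Zd) (n : nat) : {fset Zd} := fbox (a - const_mx n%:Z) n.*2.+1.

Lemma in_ball_at (a : Zd) n (k : Zd) :
  reflect (forall i, `|k 0 i - a 0 i| <= n%:Z) (k \in ball_at a n).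
Proof.
by apply: (iffP (in_fbox _ _ _)) => H i; have := H i; rewrite !coordE; lia.
Qed.

Lemma card_ball_at (a : Zd) n : #|` ball_at a n| = (n.*2.+1 ^ d)%N.
Proof. exact: card_fbox. Qed.

(** Vitali's covering argument: choosing a ball of maximal radius, the centres
    in its double are paid by the points of [S] in it, and the balls around the
    remaining centres are disjoint from it. *)
Lemma vitali_count (t : R) (P S : {fset Zd}) (rad : Zd -> nat) :
  0 < t ->
  (forall a, a \in P ->
     t * ((rad a).*2.+1 ^ d)%:R <= #|` S `&` ball_at a (rad a)|%fset%:R) ->
  t * #|` P|%:R <= 2 ^+ d * #|` S|%:R.
Proof.
move=> t0; have [n] := ubnP #|` P|; elim: n => // n IH in P S *; rewrite ltnS => Pn HP.
have [->|[a0 a0P]] := fset_0Vmem P; first by rewrite cardfs0 mulr0 mulr_ge0// exprn_ge0.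
have [a aP amax] : exists2 a, a \in P & forall b, b \in P -> (rad b <= rad a)%N.
  pose i0 : P := [` a0P]%fset.
  case: (@arg_maxnP P i0 xpredT (fun i => rad (val i))) => // i _ imax.
  exists (val i); first exact: valP.
  by move=> b bP; apply: (imax [` bP]%fset).
pose P' := [fset b in P | b \notin ball_at a (rad a).*2]%fset.
pose S' := (S `\` ball_at a (rad a))%fset.
have P'P b : b \in P' -> b \in P /\ b \notin ball_at a (rad a).*2.
  by rewrite !inE/= => /andP[].
have aP' : a \notin P'.
  apply/negP => /P'P[_ /negP]; apply; apply/in_ball_at => i.
  by rewrite subrr normr0.
have P'sub : (P' `<=` P)%fset by apply/fsubsetP => b /P'P[].
have P'n : (#|` P'| < n)%N.
  apply: leq_trans Pn; apply: fproper_ltn_card; rewrite fproperE P'sub/=.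
  by apply/fsubsetPn; exists a.
have HP' b : b \in P' ->
    t * ((rad b).*2.+1 ^ d)%:R <= #|` S' `&` ball_at b (rad b)|%fset%:R.
  move=> bP'; have [bP bfar] := P'P _ bP'; apply: le_trans (HP _ bP) _.
  rewrite ler_nat fsubset_leq_card//; apply/fsubsetP => k; rewrite !inE => /andP[kS kb].
  rewrite kS kb !andbT; apply/negP => ka; move/negP: bfar; apply.
  apply/in_ball_at => i; have := amax _ bP.
  move/in_ball_at : kb => /(_ i); move/in_ball_at : ka => /(_ i); lia.
have IH' := IH P' S' P'n HP'.
have cP : #|` P|%:R <= 2 ^+ d * ((rad a).*2.+1 ^ d)%:R + #|` P'|%:R :> R.
  have : (#|` P| <= #|` ball_at a (rad a).*2| + #|` P'|)%N.
    apply: leq_trans (fsubset_leq_card _) (leq_card_fsetU _ _).1.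
    by apply/fsubsetP => b bP; rewrite !inE/= bP /=; case: (b \in _).
  rewrite -(ler_nat R) natrD => /le_trans; apply; rewrite lerD2r card_ball_at.
  rewrite -natrX -natrM ler_nat -expnMn.
  by case: (d) => // d'; rewrite leq_exp2r//; lia.
have cS : #|` S|%:R = #|` S `&` ball_at a (rad a)|%fset%:R + #|` S'|%:R :> R.
  by rewrite -natrD cardfsID.
have Ha := HP _ aP.
have t2 : 2 ^+ d * (t * ((rad a).*2.+1 ^ d)%:R) <=
    2 ^+ d * #|` S `&` ball_at a (rad a)|%fset%:R :> R.
  by rewrite ler_wpM2l// exprn_ge0.
rewrite cS mulrDr.
apply: le_trans (_ : t * (2 ^+ d * ((rad a).*2.+1 ^ d)%:R + #|` P'|%:R) <= _).
  by rewrite ler_wpM2l// ltW.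
by rewrite mulrDr mulrCA lerD.
Qed.

Lemma probability_sum_le dd (T : measurableType dd) (Q : probability T R)
    (I J : eqType) (r : seq I) (s : seq J) (X : I -> set T) (Y : J -> set T) (c c' : R) :
  0 <= c -> 0 <= c' ->
  (forall i, measurable (X i)) -> (forall j, measurable (Y j)) ->
  (forall z, c * \sum_(i <- r) \1_(X i) z <= c' * \sum_(j <- s) \1_(Y j) z) ->
  c * \sum_(i <- r) rprob Q (X i) <= c' * \sum_(j <- s) rprob Q (Y j).
Proof.
move=> c0 c'0 mX mY XY.
have intE (K : eqType) (v : seq K) (Z : K -> set T) (e : R) : 0 <= e ->
    (forall i, measurable (Z i)) ->
    (\int[Q]_z (e * \sum_(i <- v) \1_(Z i) z)%:E = (e * \sum_(i <- v) rprob Q (Z i))%:E)%E.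
  move=> e0 mZ; under eq_integral do rewrite EFinM -sumEFin.
  rewrite ge0_integralZl_EFin//.
  - rewrite ge0_integral_sum//.
      rewrite EFinM -sumEFin; congr (_ * _)%E; apply: eq_bigr => i _.
      by rewrite integral_indic// setIT; exact: rprobE.
    by move=> i; apply/measurable_EFinP; exact: measurable_indic.
  - by move=> z _; apply: sume_ge0 => i _; rewrite lee_fin.
  - apply: emeasurable_sum => i; apply/measurable_EFinP; exact: measurable_indic.
rewrite -lee_fin -!intE//; apply: ge0_le_integral => //.
- by move=> z _; rewrite lee_fin mulr_ge0// sumr_ge0.
- apply/measurable_EFinP/measurable_funM => //.
  by apply: measurable_sum => i; exact: measurable_indic.
- apply/measurable_EFinP/measurable_funM => //.
  by apply: measurable_sum => i; exact: measurable_indic.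
- by move=> z _; rewrite lee_fin XY.
Qed.

Lemma integral_le_monotone dd (T : measurableType dd) (Q : {measure set T -> \bar R})
    (f g : T -> \bar R) :
  (forall z, 0 <= f z)%E -> (forall z, f z <= g z)%E ->
  (\int[Q]_z f z <= \int[Q]_z g z)%E.
Proof.
move=> f0 fg; have g0 z : (0 <= g z)%E by exact: le_trans (f0 z) (fg z).
rewrite !ge0_integralTE//; apply: ereal_sup_le => _ [h hf <-]; exists h => // z.
exact: le_trans (hf z) (fg z).
Qed.

End Maximal.

Section HammingIntegral.
Context (R : realType) (d : nat) (A : alphabetType).
Local Notation Zd := 'rV[int]_d.
Local Notation pairs := (borel_conf d (A * A)%type).
Variable Lam : probability pairs R.
Hypothesis Lam_inv : shift_invariant Lam.

Let D (k : Zd) : set pairs := [set z | (z k).1 <> (z k).2].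

Let D_cylinder k : cylinder (D k).
Proof. by exists [fset k]%fset => x y xy; rewrite /D/= xy// inE. Qed.

Let D_shift k : rprob Lam (D k) = rprob Lam (D 0).
Proof.
rewrite /rprob -(Lam_inv k (cylinder_measurable (D_cylinder 0))).
by congr (fine (Lam _)); apply/funext => z; rewrite /D /shift_conf /= addr0.
Qed.

Let disc (z : pairs) (a : Zd) (n : nat) : {fset Zd} :=
  [fset k in ball_at a n | (z k).1 != (z k).2]%fset.

Let disc_shift z a n : #|` disc (shift_conf a z) 0 n| = #|` disc z a n|.
Proof.
have -> : disc z a n = [fset (a + k)%R | k in disc (shift_conf a z) 0 n]%fset.
  apply/fsetP => k; rewrite !inE/=; apply/andP/imfsetP => [[ka zk]|[k' /= + ->]].
    exists (k - a); last by rewrite subrKC.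
    rewrite /= !inE /shift_conf subrKC zk andbT; apply/in_ball_at => i.
    by move/in_ball_at : ka => /(_ i); rewrite !coordE; lia.
  rewrite !inE => /andP[k'0 zk']; split => //; apply/in_ball_at => i.
  by move/in_ball_at : k'0 => /(_ i); rewrite !coordE; lia.
by rewrite [RHS]card_imfset//; exact: addrI.
Qed.

Let hammingE (z : pairs) : hamming R (conf1 z) (conf2 z) =
  limn_esup (fun n => ((#|` disc z 0 n|)%:R / ((n.*2.+1 ^ d)%N)%:R : R)%:E).
Proof.
rewrite /hamming /density; congr limn_esup; apply/funext => n.
congr ((_%:R / _)%:E); congr (#|` _|); apply/fsetP => k.
have fin : finite_set ([set k | conf1 z k <> conf2 z k] `&` @box d n).
  by apply: sub_finite_set (@subIsetr _ _ _) _; rewrite boxE; exact: finite_fset.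
rewrite in_fset_set// !inE/=; apply/asboolP/andP => [[/= zk kn]|[kn /eqP zk]].
  by split; [apply/in_ball_at => i; have := kn i; rewrite coordE subr0|apply/eqP].
by split => // i; move/in_ball_at : kn => /(_ i); rewrite coordE subr0.
Qed.

Section Threshold.
Variable t : R.
Hypothesis t_gt0 : 0 < t.

Let E (N : nat) : set pairs :=
  [set z | exists2 n, (n <= N)%N & t * ((n.*2.+1 ^ d)%N)%:R < (#|` disc z 0 n|)%:R].

Let E_cylinder N : cylinder (E N).
Proof.
exists (ball_at 0 N) => x y xy [n nN nx]; exists n => //.
rewrite (_ : disc y 0 n = disc x 0 n)//; apply/fsetP => k; rewrite !inE/=.
case kn : (k \in _) => //=; rewrite xy//; apply/in_ball_at => i.
by move/in_ball_at : kn => /(_ i); lia.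
Qed.

(** Wiener's maximal inequality: by Vitali's argument, the points of a large
    ball where some ball of radius at most [N] is bad are dominated by the
    discrepancies in the double ball. *)
Let maximal N : rprob Lam (E N) <= 4 ^+ d * rprob Lam (D 0) / t.
Proof.
have mE : measurable (E N) by exact: cylinder_measurable.
have Ea a : rprob Lam (shift_conf a @^-1` E N) = rprob Lam (E N).
  by rewrite /rprob Lam_inv.
have mEa (a : Zd) : measurable (shift_conf a @^-1` E N : set pairs).
  exact: (local_preimage (@local_map_shift d _ a)).
have key : t * \sum_(a <- @ball_at d 0 N) rprob Lam (shift_conf a @^-1` E N) <=
    2 ^+ d * \sum_(k <- @ball_at d 0 N.*2) rprob Lam (D k).
  apply: probability_sum_le => [|||k|z].
  - exact: ltW.
  - exact: exprn_ge0.
  - exact: mEa.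
  - exact: cylinder_measurable.
  have count (s : {fset Zd}) (X : Zd -> set pairs) :
      \sum_(a <- s) \1_(X a) z = (#|` [fset a in s | `[< X a z >]]%fset|)%:R :> R.
    rewrite (big_fsetID _ (fun a => `[< X a z >]))/= [X in _ + X]big1_seq ?addr0.
      rewrite -[RHS]mulr1n -[in RHS](mul1r 1) -[RHS]mulr_natl.
      rewrite (eq_big_seq (fun=> 1)); last first.
        by move=> a; rewrite !inE => /andP[_ /asboolP Xa]; rewrite indicE mem_set.
      by rewrite big_const_seq count_predT iter_addr_0 mulr1 mul1r.
    by move=> a /andP[_]; rewrite !inE => /andP[_ /asboolP nX]; rewrite indicE memNset.
  rewrite !count.
  have rad a : exists n, z \in (shift_conf a @^-1` E N : set pairs) ->
      (n <= N)%N /\ t * ((n.*2.+1 ^ d)%N)%:R < (#|` disc z a n|)%:R.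
    have [|nz] := boolP (z \in _); last by exists 0%N.
    by rewrite inE => -[n nN zn]; exists n => _; rewrite -disc_shift.
  have [r Hr] := choice rad.
  apply: (@vitali_count _ _ _ _ _ r) => // a; rewrite !inE/= => /andP[aN /asboolP Eaz].
  have [|rN /ltW le] := Hr a; first exact: mem_set.
  apply: le_trans le _; rewrite ler_nat fsubset_leq_card//.
  apply/fsubsetP => k; rewrite !inE/= => /andP[ka zk]; rewrite ka !andbT.
  apply/andP; split; last by apply/asboolP => /eqP; exact/negP.
  apply/in_ball_at => i; move/in_ball_at : ka => /(_ i).
  by move/in_ball_at : aN => /(_ i); rewrite !coordE; lia.
have sumE (s : {fset Zd}) (f : Zd -> R) (c : R) : (forall k, f k = c) ->
    \sum_(k <- s) f k = c * (#|` s|)%:R.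
  move=> fc; rewrite (eq_bigr _ (fun k _ => fc k)).
  by rewrite big_const_seq count_predT iter_addr_0 mulr_natr.
move: key; rewrite (sumE _ _ _ Ea) (sumE _ _ _ D_shift) !card_ball_at => key.
have le2 : ((N.*2.*2.+1 ^ d)%N)%:R <= 2 ^+ d * ((N.*2.+1 ^ d)%N)%:R :> R.
  rewrite -natrX -natrM -expnMn ler_nat.
  by case: (d) => // d'; rewrite leq_exp2r//; lia.
have p0 : 0 < ((N.*2.+1 ^ d)%N)%:R :> R by rewrite ltr0n expn_gt0.
have e4 : 4 ^+ d = 2 ^+ d * 2 ^+ d :> R by rewrite -exprMn; congr (_ ^+ _); ring.
have e0 : 0 <= 2 ^+ d :> R by exact: exprn_ge0.
have D0 := rprob_ge0 Lam (D 0).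
move: key le2 p0 e0 D0; rewrite e4 ler_pdivlMr//.
move: (rprob Lam (E N)) (rprob Lam (D 0)) (2 ^+ d) ((N.*2.+1 ^ d)%N)%:R
  ((N.*2.*2.+1 ^ d)%N)%:R => e q u v w key le2 v0 u0 q0.
rewrite -(ler_pM2r v0); apply: le_trans (_ : u * (q * w) <= _).
  by rewrite [leLHS](_ : _ = t * (e * v))//; ring.
rewrite [leRHS](_ : _ = u * (q * (u * v))); last by ring.
by rewrite ler_wpM2l// ler_wpM2l.
Qed.

(** The Hamming distance is at most [t] where no ball is bad, and at most one
    elsewhere, on a set that the maximal inequality controls. This plays the role
    of the ergodic theorem, at the cost of optimising over [t] later. *)
Lemma hamming_integral_le :
  (\int[Lam]_z hamming R (conf1 z) (conf2 z) <=
   (t + 4 ^+ d * rprob Lam (D 0) / t)%:E)%E.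
Proof.
pose E' := \bigcup_N E N.
have mE N : measurable (E N) by exact: cylinder_measurable.
have mE' : measurable E' by exact: bigcup_measurable.
have E'le : (Lam E' <= (4 ^+ d * rprob Lam (D 0) / t)%:E)%E.
  have cv := @nondecreasing_cvg_mu _ _ _ Lam E mE mE'.
  have {}cv : (Lam \o E) n @[n --> \oo] --> Lam E'.
    apply: cv => m n mn; apply/subsetPset => z [k km kz]; exists k => //.
    exact: leq_trans km mn.
  rewrite -(cvg_lim _ cv)//; apply: lime_le; first by apply/cvg_ex; exists (Lam E').
  by apply: nearW => N /=; rewrite rprobE// lee_fin maximal.
have ham0 (z : pairs) : (0 <= hamming R (conf1 z) (conf2 z) :> \bar R)%E.
  rewrite (hammingE z) limn_esup_lim; apply: lime_ge; first exact: is_cvg_esups.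
  apply: nearW => n; rewrite /esups/=; apply: le_ereal_sup_tmp.
  exists ((#|` disc z 0 n|)%:R / ((n.*2.+1 ^ d)%N)%:R)%:E; first by exists n => /=.
  by rewrite lee_fin.
have ham_le (z : pairs) c : (forall n, (#|` disc z 0 n|)%:R <= c * ((n.*2.+1 ^ d)%N)%:R) ->
    (hamming R (conf1 z) (conf2 z) <= c%:E)%E.
  move=> le; rewrite (hammingE z) limn_esup_lim; apply: lime_le; first exact: is_cvg_esups.
  apply: nearW => n; rewrite /esups/=; apply: ge_ereal_sup => _ [k _ <-].
  by rewrite lee_fin ler_pdivrMr// ltr0n expn_gt0.
apply: (@le_trans _ _ (\int[Lam]_z (t%:E + (\1_E' z)%:E))%E).
  apply: integral_le_monotone => // z.
  have [zE|zE] := pselect (E' z).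
    rewrite indicE mem_set// -EFinD; apply: ham_le => n.
    apply: le_trans (_ : ((n.*2.+1 ^ d)%N)%:R <= _).
      rewrite ler_nat -(card_ball_at (0 : Zd) n) fsubset_leq_card//.
      by apply/fsubsetP => k; rewrite !inE => /andP[].
    by rewrite mulrDl mul1r lerDr mulr_ge0// ltW.
  rewrite indicE memNset// adde0; apply: ham_le => n.
  by rewrite leNgt; apply/negP => lt; apply: zE; exists n => //; exists n.
rewrite ge0_integralD//.
- have i1 : (\int[Lam]_z t%:E = t%:E)%E.
    by rewrite integral_cst//= -[RHS]mule1; congr (_ * _)%E; exact: probability_setT.
  by rewrite i1 integral_indic// setIT EFinD leeD2l.
- by move=> z _; rewrite lee_fin ltW.
- by apply/measurable_EFinP; exact: measurable_indic.
Qed.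

End Threshold.
End HammingIntegral.

(** * Phases of an almost periodic subshift *)

Section Phases.
Context (d : nat) (A : alphabetType).
Local Notation Zd := 'rV[int]_d.
Variables (F : {fset pattern d A}) (p C : nat) (G : set Zd).
Hypothesis p_gt0 : (0 < p)%N.
Hypothesis G_periodic : periodic_set p G.
Hypothesis FG : reconstruction F p C G.

Local Notation h := (uphalf p).
Local Notation r := (h + C)%N.
Implicit Types (x : conf d A) (k : Zd) (Y : conf d (option A)) (T : set Zd).

Definition window_ok x k := locally_admissible F (box r) (shift_conf k x).

(** A phase is expressed in absolute coordinates, so that phases read off around
    different sites can be compared. *)
Definition phase_at x k Y := exists T, [/\ grid_translates p G T,
  blank_SFT F p G (shift_conf k Y) &
  forall j, box h j -> Y (k + j) = blank T (shift_conf k x) j].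

Definition phase_of x k : conf d (option A) := xget (fun=> None) (phase_at x k).

Lemma mem_translate k T j : translate k T j <-> T (j - k).
Proof.
by split=> [[i Ti <-]|Tj]; [rewrite addrK|exists (j - k); rewrite ?subrK].
Qed.

Lemma phase_ofP x k : window_ok x k -> phase_at x k (phase_of x k).
Proof.
move=> xk; rewrite /phase_of; case: xgetP => [Y _ //|noY].
have [T [[gT [y yF yT]] _]] := FG.1 _ xk.
exfalso; apply: (noY (shift_conf (- k) y)); exists T; split => //.
  have -> : shift_conf k (shift_conf (- k) y) = y.
    by apply: funext => j; rewrite /shift_conf addKr.
  by [].
by move=> j hj; rewrite /shift_conf addKr yT.
Qed.

Lemma grid_translate_periodic T j v : grid_translates p G T -> T (j + v *+ p) <-> T j.
Proof.
move=> [k _ <-]; split=> /mem_translate H; apply/mem_translate.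
  by apply/(G_periodic _ v); rewrite addrAC.
by rewrite addrAC; apply/G_periodic.
Qed.

Lemma phase_periodic x k Y j v : phase_at x k Y -> Y (j + v *+ p) = Y j.
Proof.
move=> [_ [_ [y [T [yF gT yT Yy]]] _]].
have YE i : Y i = blank T y (i - k) by rewrite -Yy /shift_conf subrKC.
rewrite !YE addrAC /blank; have TE := grid_translate_periodic (j - k) v gT.
case: ifPn => [/set_mem/TE Tj|/negP nT]; first by rewrite mem_set.
have nTj : ~ T (j - k) by move=> Tj; apply: nT; apply/mem_set/TE.
by rewrite memNset// yT.
Qed.

Lemma cube_decomposition (b j : Zd) : exists u v, cube p u /\ j = b + u + v *+ p.
Proof.
have p0 : (0 : int) < p by lia.
pose q i := (j - b) 0 i.
exists (\row_i modz (q i) p%:Z), (\row_i divz (q i) p%:Z); split.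
  by move=> i; rewrite mxE modz_ge0 ?ltz_pmod//; lia.
apply/rowP => i; have := divz_eq (q i) p%:Z.
have -> : (b + \row_i0 modz (q i0) p%:Z + \row_i0 divz (q i0) p%:Z *+ p) 0 i =
   b 0 i + modz (q i) p%:Z + divz (q i) p%:Z * p%:Z.
  by rewrite !coordE !mxE.
move: (modz _ _) (divz _ _ * _) => m1 m2; rewrite {1}/q !coordE; lia.
Qed.

(** By the second clause of the reconstruction property, both phases have the
    same grid, since they see the same [p]-square at [b]; hence they agree on this
    square, and everywhere because they are periodic. *)
Lemma phase_overlap x x' k k' (b : Zd) Y Y' :
  window_ok x k -> window_ok x' k' -> phase_at x k Y -> phase_at x' k' Y' ->
  (forall u, cube p u -> box h (b + u - k)) ->
  (forall u, cube p u -> box h (b + u - k')) ->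
  (forall u, cube p u -> x (b + u) = x' (b + u)) -> Y = Y'.
Proof.
move=> xk xk' ph ph' bk bk' xx'.
have [T [gT YF YT]] := ph; have [T' [gT' YF' YT']] := ph'.
have cen : central_translate F p G (shift_conf k x) T.
  by split => //; exists (shift_conf k Y) => // j hj; rewrite -YT.
have cen' : central_translate F p G (shift_conf k' x') T'.
  by split => //; exists (shift_conf k' Y') => // j hj; rewrite -YT'.
have TT' : translate (- (b - k)) T = translate (- (b - k')) T'.
  apply: (FG.2 _ _ _ _ _ _ xk xk' cen cen').
  - by move=> _ [u cu <-]; rewrite addrCA addrA; exact: bk.
  - by move=> _ [u cu <-]; rewrite addrCA addrA; exact: bk'.
  - by move=> u cu; rewrite /shift_conf (addrA k) (addrA k') !subrKC xx'.
have TE j : T (j - k) <-> T' (j - k').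
  have e1 : j - k = j - b - - (b - k) by rewrite opprK addrA subrK.
  have e2 : j - k' = j - b - - (b - k') by rewrite opprK addrA subrK.
  by rewrite e1 e2 -!mem_translate TT'.
have eq u : cube p u -> Y (b + u) = Y' (b + u).
  move=> cu; have := YT _ (bk u cu); have := YT' _ (bk' u cu).
  rewrite !subrKC => -> ->; rewrite /blank /shift_conf !subrKC xx'//.
  have {}TE := TE (b + u).
  case: ifPn => [/set_mem/TE Tj|/negP nT]; first by rewrite mem_set.
  by rewrite memNset// => T'j; apply: nT; apply/mem_set/TE.
apply: funext => j; have [u [v [cu ->]]] := cube_decomposition b j.
by rewrite (phase_periodic _ _ ph) (phase_periodic _ _ ph') eq.
Qed.

Lemma phase_of_restrict x x' k : (forall j, box r j -> x (k + j) = x' (k + j)) ->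
  window_ok x k -> window_ok x' k /\ phase_of x k = phase_of x' k.
Proof.
move=> xx' xk.
have xk' : window_ok x' k.
  move=> w l wF wr mw; apply: (xk w l wF wr) => i iw.
  by rewrite (mw i iw) /shift_conf xx'//; exact: wr.
split => //; have sub u : cube p u -> box h (k - const_mx h%:Z + u - k).
  by move=> cu i; have := cu i; rewrite !coordE; lia.
apply: (phase_overlap xk xk' (phase_ofP xk) (phase_ofP xk') sub sub) => u cu.
have -> : k - const_mx h%:Z + u = k + (u - const_mx h%:Z) by rewrite -addrA [- _ + _]addrC.
by apply: xx' => i; have := cu i; rewrite !coordE; lia.
Qed.

Lemma phase_of_step x k i : window_ok x k -> window_ok x (k + delta_mx 0 i) ->
  phase_of x k = phase_of x (k + delta_mx 0 i).
Proof.
move=> xk xk'.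
(* As [2 * uphalf p >= p], the windows around neighbouring sites share a [p]-square:
   the lowest one of the second window. *)
apply: (phase_overlap (b := k - const_mx h%:Z + delta_mx 0 i) xk xk'
  (phase_ofP xk) (phase_ofP xk')) => //.
  move=> u cu j; have := cu j; rewrite !coordE; case: (j == i) => /=; lia.
move=> u cu j; have := cu j; rewrite !coordE; case: (j == i) => /=; lia.
Qed.

(** Unit steps towards [k + u] inside the box spanned by [k] and [k + u]. *)
Lemma phase_of_walk x k (u : Zd) : (forall i, 0 <= u 0 i) ->
  (forall v : Zd, (forall i, 0 <= v 0 i <= u 0 i) -> window_ok x (k + v)) ->
  phase_of x k = phase_of x (k + u).
Proof.
have [n] := ubnP (\sum_i absz (u 0%R i)).
elim: n => // n IH in u *; rewrite ltnS => un u0 uok.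
have [->|u0'] := eqVneq u 0; first by rewrite addr0.
have [i ui] : exists i, 0 < u 0 i.
  apply: contrapT => noi; move/eqP: u0'; apply; apply/rowP => i; rewrite !mxE.
  have := u0 i; rewrite le_eqVlt => /orP[/eqP <-//|ui]; case: noi; by exists i.
pose u' : Zd := u - delta_mx 0 i.
have u'E : u' + delta_mx 0 i = u by rewrite subrK.
have u'0 j : 0 <= u' 0 j.
  by have := u0 j; rewrite !coordE; case: eqP => [->|] /=; lia.
have leu (v : Zd) : (forall j, 0 <= v 0 j <= u' 0 j) -> window_ok x (k + v).
  move=> vu'; apply: uok => j; have := vu' j; rewrite !coordE; case: (j == i) => /=; lia.
rewrite (IH u')//.
  have -> : k + u = k + u' + delta_mx 0 i by rewrite -[in LHS]u'E addrA.
  apply: phase_of_step.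
    by apply: leu => j; rewrite u'0 lexx.
  by rewrite -addrA u'E; apply: uok => j; rewrite u0 lexx.
apply: leq_trans un; apply: (@leq_trans (\sum_j absz (u' 0%R j)).+1) => //.
rewrite (bigD1 i)//= [leqRHS](bigD1 i)//= -addSn leq_add//.
  by rewrite !coordE eqxx /=; lia.
apply: leq_sum => j /negPf ji; rewrite !coordE ji/=; lia.
Qed.

Lemma phase_of_centre x k : window_ok x k ->
  phase_of x k k = None \/ phase_of x k k = Some (x k).
Proof.
move=> /phase_ofP [T [_ _ /(_ 0)]]; rewrite addr0 => ->.
  by rewrite /blank /shift_conf addr0; case: ifP; [left|right].
by move=> i; rewrite coordE normr0.
Qed.

(** Elements of the blanked subshift are blanked globally admissible
    configurations, which is what lets a phase be completed. *)
Lemma phase_of_completion x : window_ok x 0 ->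
  exists y T, [/\ SFT F y, grid_translates p G T & phase_of x 0 = blank T y].
Proof.
move=> /phase_ofP [_ [_ [y [T [yF gT _ e]]] _]]; exists y, T; split => //.
by rewrite -e; apply: funext => j; rewrite /shift_conf add0r.
Qed.

End Phases.

Lemma clear_window_ok (d : nat) (A : alphabetType) (F : {fset pattern d A})
    (p C : nat) (z : conf d (A * bool)) (k : 'rV[int]_d) :
  SFT (noisy_patterns F) z ->
  (forall j, box (uphalf p + C) j -> (z (k + j)).2 = false) ->
  window_ok F p C (conf1 z) k.
Proof.
move=> zF clear w l wF wr mw.
apply: (zF (clear_pattern w) (k + l)); first by apply/imfsetP; exists w.
move=> i iw; have iw' : i \in domf w by move: iw; rewrite /=.
rewrite /clear_pattern in_fnd ffunE/=; congr Some.
have := mw i iw'; rewrite in_fnd => -[wi].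
have zi := clear _ (wr i iw').
rewrite (_ : w _ = w [` iw']%fset); last by congr (w _); exact: val_inj.
rewrite wi /shift_conf /conf1 -addrA; move: zi; case: (z _) => a b /= ->//.
Qed.

(** * The hierarchy of cells *)

Section Ancestors.
Variable d : nat.
Local Notation Zd := 'rV[int]_d.
Implicit Types q Q u : Zd.

Definition ancestor (j : nat) q : Zd := \row_i divz (q 0 i) ((3 ^ j)%N)%:Z.

Lemma ancestor0 q : ancestor 0 q = q.
Proof. by apply/rowP => i; rewrite mxE divz1. Qed.

Lemma ancestorS j q : exists2 u, cube 3 u & ancestor j q = ancestor j.+1 q *+ 3 + u.
Proof.
exists (\row_i modz (ancestor j q 0 i) 3).
  by move=> i; rewrite mxE modz_ge0 ?ltz_pmod.
apply/rowP => i; rewrite coordD coordMn !mxE expnSr PoszM divzMA_ge0//.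
exact: divz_eq.
Qed.

Lemma ancestor_eq j q Q u : cube 3 u -> ancestor j q = Q *+ 3 + u -> ancestor j.+1 q = Q.
Proof.
move=> cu; have [u' cu' ->] := ancestorS j q => /rowP e; apply/rowP => i.
by have := e i; have := cu i; have := cu' i; rewrite !coordE; lia.
Qed.

Lemma ancestor_nneg q : (forall i, 0 <= q 0 i) -> exists J, ancestor J q = 0.
Proof.
move=> q0; exists (\max_i absz (q 0%R i)); apply/rowP => i; rewrite !mxE.
apply: divz_small; rewrite q0/=.
have : (absz (q 0%R i) <= \max_i absz (q 0%R i))%N by exact: (leq_bigmax i).
have := ltn_expl (\max_i absz (q 0%R i)) (isT : 1 < 3)%N.
have := q0 i; move: (\max_i _)%N (3 ^ _)%N (q 0 i) => M e a; lia.
Qed.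

End Ancestors.

Section Renormalisation.
Variable d : nat.
Local Notation Zd := 'rV[int]_d.
Hypothesis d_ge2 : (2 <= d)%N.
Implicit Types (bad : set Zd) (u v k q Q : Zd).

(** Cells of side 3 are bad when two of their subcells are: one bad subcell does
    not disconnect the others, and two are quadratically unlikely. *)
Definition coarse bad : set Zd := [set Q | exists u v,
  [/\ cube 3 u, cube 3 v, u <> v, bad (Q *+ 3 + u) & bad (Q *+ 3 + v)]].

Section Coherence.
Variable Y : choiceType.
Implicit Type f : Zd -> Y.

Definition coherent bad f := forall Q i, ~ bad Q -> ~ bad (Q + delta_mx 0 i) ->
  f Q = f (Q + delta_mx 0 i).

Lemma other_direction (i : 'I_d) : exists j : 'I_d, j != i.
Proof.
have [->|i0] := eqVneq i (Ordinal (ltnW d_ge2)); first by exists (Ordinal d_ge2).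
by exists (Ordinal (ltnW d_ge2)); rewrite eq_sym.
Qed.

(** A cube of side 3 with one cell removed is connected, in dimension at least
    two: a move towards the target that hits the removed cell can be replaced
    by another one, or by a detour when the target lies just behind it. *)
Lemma coarse_connected bad f Q u v : coherent bad f -> ~ coarse bad Q ->
  cube 3 u -> cube 3 v -> ~ bad (Q *+ 3 + u) -> ~ bad (Q *+ 3 + v) ->
  f (Q *+ 3 + u) = f (Q *+ 3 + v).
Proof.
move=> fc nQ.
pose B (w : Zd) := bad (Q *+ 3 + w); pose g (w : Zd) := f (Q *+ 3 + w).
have B1 (w w' : Zd) : cube 3 w -> cube 3 w' -> B w -> B w' -> w = w'.
  by move=> cw cw' Bw Bw'; apply: contrapT => ww'; apply: nQ; exists w, w'.
pose mv (w : Zd) (i : 'I_d) (s : bool) : Zd :=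
  if s then w + delta_mx 0 i else w - delta_mx 0 i.
have mvE (w : Zd) i s j : mv w i s 0 j = w 0 j + (if s then 1 else -1) * (j == i)%:Z.
  by rewrite /mv; case: s; rewrite !coordE; lia.
have step (w : Zd) i s : ~ B w -> ~ B (mv w i s) -> g w = g (mv w i s).
  rewrite /mv /B /g; case: s => nB nB'.
    by rewrite addrA; apply: fc; rewrite // -addrA.
  have e : Q *+ 3 + w = Q *+ 3 + (w - delta_mx 0 i) + delta_mx 0 i.
    by rewrite -[RHS]addrA subrK.
  by rewrite [in LHS]e; apply/esym/fc; rewrite // -e.
rewrite -/(g u) -/(g v) -/(B u) -/(B v).
have [n] := ubnP (\sum_i absz (v 0%R i - u 0%R i)%R); elim: n => // n IH in u *.
rewrite ltnS => un cu cv nBu nBv.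
have [->//|uv] := eqVneq u v.
pose sg i := u 0 i < v 0 i.
have mvcube i : u 0 i != v 0 i -> cube 3 (mv u i (sg i)).
  move=> ui j; have := cu j; have := cv j; rewrite mvE /sg.
  case: eqVneq => [->|_] /=; last by case: ifP; lia.
  by case: (ltP (u 0 i) (v 0 i)); lia.
have [[i [ui nBi]]|block] := pselect (exists i, u 0 i != v 0 i /\ ~ B (mv u i (sg i))).
  rewrite (step u i (sg i) nBu nBi); apply: IH => //; last exact: mvcube.
  apply: leq_trans un; rewrite (bigD1 i)//= [leqRHS](bigD1 i)//= -addSn leq_add//.
    by rewrite mvE eqxx /sg; move: ui; case: (ltP (u 0 i) (v 0 i)) => ? ?; lia.
  by apply: leq_sum => j /negPf ji; rewrite mvE ji; lia.
have [i ui] : exists i, u 0 i != v 0 i.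
  apply: contrapT => noi; move/eqP: uv; apply; apply/rowP => i.
  by apply: contrapT => /eqP ui; apply: noi; exists i.
have Bi j : u 0 j != v 0 j -> B (mv u j (sg j)).
  by move=> uj; apply: contrapT => nB; apply: block; exists j.
have same j : j != i -> u 0 j = v 0 j.
  move=> ji; apply: contrapT => /eqP uj.
  have := B1 _ _ (mvcube j uj) (mvcube i ui) (Bi j uj) (Bi i ui).
  move=> /rowP /(_ j); rewrite !mvE eqxx (negPf ji); case: (sg j) => /=; lia.
have vE : v <> mv u i (sg i) by move=> e; apply: nBv; rewrite e; exact: Bi.
have vi : v 0 i = u 0 i + (if sg i then 1 else -1) * 2.
  have : v 0 i != mv u i (sg i) 0 i.
    apply/eqP => e; apply: vE; apply/rowP => j; have [->//|ji] := eqVneq j i.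
    by rewrite mvE (negPf ji) -same//; lia.
  have := cu i; have := cv i; move: ui; rewrite mvE eqxx /sg.
  by case: (ltP (u 0 i) (v 0 i)) => /=; lia.
have [j ji] := other_direction i.
(* The detour goes one step aside in direction [j], two steps ahead, and back. *)
pose t := u 0 j < 2.
pose a := mv u j t; pose b := mv a i (sg i); pose c := mv b i (sg i).
have nB (w : Zd) : cube 3 w -> w 0 j = u 0 j + (if t then 1 else -1) -> ~ B w.
  move=> cw wj Bw; have := B1 _ _ cw (mvcube i ui) Bw (Bi i ui).
  by move=> /rowP /(_ j); rewrite wj mvE (negPf ji); case: (t); lia.
have cdE : mv c j (~~ t) = v.
  apply/rowP => k; rewrite /c /b /a !mvE; have [->|ki] := eqVneq k i.
    by rewrite vi eq_sym (negPf ji); case: (sg i); lia.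
  by rewrite -(same _ ki); case: (t); case: (k == j) => /=; lia.
have ca : cube 3 a.
  move=> k; have := cu k; rewrite /a mvE /t.
  have [->|_] := eqVneq k j => /=; last by case: ifP; lia.
  by case: (ltP (u 0 j) 2); lia.
have cb : cube 3 b.
  move=> k; have := ca k; rewrite /b mvE.
  have [->|_] := eqVneq k i => /=; last by case: (sg i); lia.
  have := cu i; have := cv i; rewrite vi /a mvE eq_sym (negPf ji).
  by case: (sg i) => /=; lia.
have cc : cube 3 c.
  move=> k; have := cb k; rewrite /c mvE.
  have [->|_] := eqVneq k i => /=; last by case: (sg i); lia.
  have := cu i; have := cv i; rewrite vi /b /a !mvE eqxx eq_sym (negPf ji).
  by case: (sg i) => /=; lia.
have nBa : ~ B a by apply: nB => //; rewrite /a mvE eqxx; lia.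
have nBb : ~ B b by apply: nB => //; rewrite /b /a !mvE eqxx (negPf ji); lia.
have nBc : ~ B c by apply: nB => //; rewrite /c /b /a !mvE eqxx (negPf ji); lia.
rewrite (step u j t nBu nBa) (step a i (sg i) nBa nBb) (step b i (sg i) nBb nBc).
by rewrite (step c j (~~ t)) ?cdE.
Qed.

Definition coarse_map bad f : Zd -> Y := fun Q =>
  xget (f 0) [set y | exists u, [/\ cube 3 u, ~ bad (Q *+ 3 + u) & y = f (Q *+ 3 + u)]].

Lemma coarse_mapE bad f Q u : coherent bad f -> ~ coarse bad Q ->
  cube 3 u -> ~ bad (Q *+ 3 + u) -> coarse_map bad f Q = f (Q *+ 3 + u).
Proof.
move=> fc nQ cu nu; rewrite /coarse_map; case: xgetP => [_ _ [v [cv nv ->]]|no].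
  exact: (coarse_connected fc nQ).
by exfalso; apply: (no (f (Q *+ 3 + u))); exists u.
Qed.

(** Two adjacent coarse cells touch along at least three pairs of cells, of
    which at most two meet a bad cell. *)
Lemma coherent_coarse bad f : coherent bad f -> coherent (coarse bad) (coarse_map bad f).
Proof.
move=> fc Q i nQ nQ'; have [j ji] := other_direction i.
pose u (t : nat) : Zd := delta_mx 0 i *+ 2 + delta_mx 0 j *+ t.
pose u' (t : nat) : Zd := delta_mx 0 j *+ t.
have uE t (k : 'I_d) : u t 0 k = (k == i)%:Z * 2 + (k == j)%:Z * t%:Z.
  by rewrite !coordE; lia.
have u'E t (k : 'I_d) : u' t 0 k = (k == j)%:Z * t%:Z by rewrite !coordE.
have cu t : (t < 3)%N -> cube 3 (u t).
  move=> t3 k; rewrite uE.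
  case: eqVneq => [->|_]; rewrite 1?eq_sym ?(negPf ji)/=; first lia.
  by case: (k == j) => /=; lia.
have cu' t : (t < 3)%N -> cube 3 (u' t).
  by move=> t3 k; rewrite u'E; case: (k == j) => /=; lia.
have uI t s : u t = u s -> t = s.
  by move=> /rowP/(_ j); rewrite !uE eqxx (negPf ji); lia.
have u'I t s : u' t = u' s -> t = s.
  by move=> /rowP/(_ j); rewrite !u'E eqxx; lia.
have [t [t3 nu nu']] : exists t, [/\ (t < 3)%N, ~ bad (Q *+ 3 + u t) &
    ~ bad ((Q + delta_mx 0 i) *+ 3 + u' t)].
  apply: contrapT => no.
  have B1 t s : (t < 3)%N -> (s < 3)%N -> t <> s -> bad (Q *+ 3 + u t) ->
      bad (Q *+ 3 + u s) -> False.
    move=> t3 s3 ts bt bs; apply: nQ; exists (u t), (u s).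
    split=> //; [exact: cu|exact: cu|].
    by move=> /uI.
  have B2 t s : (t < 3)%N -> (s < 3)%N -> t <> s -> bad ((Q + delta_mx 0 i) *+ 3 + u' t) ->
      bad ((Q + delta_mx 0 i) *+ 3 + u' s) -> False.
    move=> t3 s3 ts bt bs; apply: nQ'; exists (u' t), (u' s).
    split=> //; [exact: cu'|exact: cu'|].
    by move=> /u'I.
  have or t : (t < 3)%N -> bad (Q *+ 3 + u t) \/ bad ((Q + delta_mx 0 i) *+ 3 + u' t).
    move=> t3; apply: contrapT => /not_orP[n1 n2]; apply: no; by exists t.
  case: (or 0%N isT) => b0; case: (or 1%N isT) => b1; case: (or 2%N isT) => b2;
    solve [exact: (B1 0%N 1%N) | exact: (B1 0%N 2%N) | exact: (B1 1%N 2%N)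
          |exact: (B2 0%N 1%N) | exact: (B2 0%N 2%N) | exact: (B2 1%N 2%N)].
rewrite (coarse_mapE fc nQ (cu t t3) nu) (coarse_mapE fc nQ' (cu' t t3) nu').
have e : (Q + delta_mx 0 i) *+ 3 + u' t = Q *+ 3 + u t + delta_mx 0 i.
  by apply/rowP => k; rewrite !coordE; lia.
by rewrite e; apply: fc; rewrite // -e.
Qed.

End Coherence.

Definition bad_at (j : nat) bad : set Zd := iter j coarse bad.

(** As long as all the ancestors of a cell are good, its value is transmitted from
    each of them to the next one; and [q] shares its ancestor of level [J] with
    the cell [0]. *)
Lemma coherent_ancestors (Y : choiceType) q J bad (f : Zd -> Y) :
  ancestor J q = 0 -> coherent bad f ->
  (forall j, (j <= J)%N -> ~ bad_at j bad 0 /\ ~ bad_at j bad (ancestor j q)) ->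
  f q = f 0.
Proof.
move=> qJ fc good.
pose fs := fix fs j := if j is j'.+1 then coarse_map (bad_at j' bad) (fs j') else f.
have cs j : coherent (bad_at j bad) (fs j).
  by elim: j => [//|j IH]; exact: coherent_coarse.
have climb k : (forall j, (j <= J)%N -> ~ bad_at j bad (ancestor j k)) ->
    forall j, (j <= J)%N -> fs j (ancestor j k) = f k.
  move=> gk; elim=> [|j IH] jJ; first by rewrite ancestor0.
  rewrite -(IH (ltnW jJ)); have [u cu e] := ancestorS j k.
  have nb : ~ bad_at j bad (ancestor j.+1 k *+ 3 + u) by rewrite -e; apply: gk; exact: ltnW.
  rewrite e; exact: (coarse_mapE (cs j) (gk _ jJ) cu nb).
have anc0 j : ancestor j 0 = 0 by apply/rowP => i; rewrite !mxE div0z.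
rewrite -(climb q _ J (leqnn J)); last by move=> j /good[].
rewrite qJ -(climb 0 _ J (leqnn J)) ?anc0// => j /good[]; by rewrite anc0.
Qed.

End Renormalisation.

Section Witnesses.
Variable d : nat.
Local Notation Zd := 'rV[int]_d.
Implicit Types (b : conf d bool) (S : {fset Zd}) (q Q : Zd).

Definition noisy_block (r : nat) b : set Zd :=
  [set Q | exists2 s, s \in ball_at (Q *+ r.*2.+1) r & b s].

Lemma block_unique (r : nat) q q' s :
  s \in ball_at (q *+ r.*2.+1) r -> s \in ball_at (q' *+ r.*2.+1) r -> q = q'.
Proof.
move=> /in_ball_at sq /in_ball_at sq'; apply/rowP => i.
have := sq i; rewrite !coordE ler_norml; have := sq' i; rewrite !coordE ler_norml.
move: (q 0 i) (q' 0 i) (s 0 i) => x y z; nia.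
Qed.

Lemma size_flatten_le (X Y : eqType) (f : X -> seq Y) (s : seq X) m :
  (forall x, x \in s -> (size (f x) <= m)%N) ->
  (size (flatten (map f s)) <= size s * m)%N.
Proof.
elim: s => [//|x s IH] H; rewrite /= size_cat mulSn leq_add//; first exact/H/mem_head.
by apply: IH => y ys; apply: H; rewrite inE ys orbT.
Qed.

(** Unfolding badness down to level zero doubles at each level the number of
    noisy sites, taken in disjoint cells. The number of possible positions at most
    squares from one level to the next, up to the factor [9 ^ d] that counts the
    pairs of subcells. *)
Lemma witness_cover (r j : nat) Q : exists W : seq {fset Zd},
  [/\ (9 ^ d * size W <= (9 ^ d * r.*2.+1 ^ d) ^ (2 ^ j))%N,
      forall S, S \in W -> #|` S| = (2 ^ j)%N /\
        (forall s, s \in S ->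
          exists q, s \in ball_at (q *+ r.*2.+1) r /\ ancestor j q = Q) &
      forall b, bad_at j (noisy_block r b) Q ->
        exists2 S, S \in W & forall s, s \in S -> b s].
Proof.
elim: j Q => [|j IH] Q.
  exists [seq [fset s]%fset | s <- ball_at (Q *+ r.*2.+1) r]; split.
  - by rewrite size_map card_ball_at.
  - move=> S /mapP[s sQ ->]; split; first by rewrite cardfs1.
    by move=> s'; rewrite inE => /eqP ->; exists Q; rewrite ancestor0.
  - move=> b [s sQ bs]; exists [fset s]%fset; first exact: map_f.
    by move=> s'; rewrite inE => /eqP ->.
have [W HW] := choice IH.
pose pairs := [seq uv <- [seq (u, v) | u <- @fbox d 0 3, v <- @fbox d 0 3] | uv.1 != uv.2].
pose glue (uv : Zd * Zd) :=
  [seq (S1 `|` S2)%fset | S1 <- W (Q *+ 3 + uv.1), S2 <- W (Q *+ 3 + uv.2)].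
exists (flatten (map glue pairs)); split.
- set M := ((9 ^ d * r.*2.+1 ^ d) ^ (2 ^ j))%N.
  have -> : ((9 ^ d * r.*2.+1 ^ d) ^ (2 ^ j.+1) = M ^ 2)%N by rewrite -expnM expnSr.
  have c0 : (0 < 9 ^ d)%N by rewrite expn_gt0.
  have cc0 : (0 < 9 ^ d * 9 ^ d)%N by rewrite muln_gt0 c0.
  have sp : (size pairs <= 9 ^ d)%N.
    rewrite size_filter; apply: leq_trans (count_size _ _) _.
    by rewrite size_allpairs !card_fbox -expnMn.
  have sg uv : uv \in pairs -> (size (glue uv) <= M ^ 2 %/ (9 ^ d * 9 ^ d))%N.
    move=> _; rewrite leq_divRL// size_allpairs mulnACA expnS expn1.
    have [W1 _ _] := HW (Q *+ 3 + uv.1); have [W2 _ _] := HW (Q *+ 3 + uv.2).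
    by rewrite leq_mul// mulnC.
  apply: leq_trans (leq_mul (leqnn _) (size_flatten_le sg)) _.
  apply: leq_trans (_ : (9 ^ d * (9 ^ d * (M ^ 2 %/ (9 ^ d * 9 ^ d))) <= _)%N).
    by rewrite leq_mul2l leq_mul2r sp !orbT.
  by rewrite mulnA mulnC leq_trunc_div.
- move=> S /flatten_mapP[uv]; rewrite mem_filter.
  move=> /andP[uv' /allpairsP[[u v] /= [cu cv uvE]]].
  subst uv; rewrite /= in uv' *; move=> /allpairsP[[S1 S2] /= [S1W S2W ->]].
  have [_ /(_ _ S1W)[S1n S1Q] _] := HW (Q *+ 3 + u).
  have [_ /(_ _ S2W)[S2n S2Q] _] := HW (Q *+ 3 + v).
  split.
    rewrite cardfsU (_ : S1 `&` S2 = fset0)%fset.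
      by rewrite cardfs0 subn0 S1n S2n expnS mul2n addnn.
    apply/fsetP => s; rewrite !inE; apply/negP => /andP[/S1Q[q [sq qu]] /S2Q[q' [sq' qv]]].
    have qq := block_unique sq sq'; subst q'; move: qv; rewrite qu => /addrI uv.
    by move/eqP: uv'.
  move=> s; rewrite inE => /orP[/S1Q|/S2Q] [q [sq e]]; exists q; split => //.
    by apply: ancestor_eq e; exact/cubeP.
  by apply: ancestor_eq e; exact/cubeP.
- move=> b [u [v [cu cv uv bu bv]]].
  have [_ _ /(_ b bu)[S1 S1W S1b]] := HW (Q *+ 3 + u).
  have [_ _ /(_ b bv)[S2 S2W S2b]] := HW (Q *+ 3 + v).
  exists (S1 `|` S2)%fset; last by move=> s; rewrite inE => /orP[/S1b|/S2b].
  move/cubeP in cu; move/cubeP in cv.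
  apply/flatten_mapP; exists (u, v); last by apply/allpairsP; exists (S1, S2).
  by rewrite mem_filter; apply/andP; split; [exact/eqP|apply/allpairsP; exists (u, v)].
Qed.

(** The sets in [W] are the witnesses of badness of the ancestors of [0] and [q].
    Those of one ancestor of level [j] weigh at most [theta ^ (2 ^ j)] in all, where
    [theta] bounds the probability that a cell of level zero is bad, up to
    counting factors; this sums to a multiple of [theta], uniformly in [q]. *)
Lemma percolation (R : realType) (r : nat) q : (2 <= d)%N -> (forall i, 0 <= q 0 i) ->
  exists W : seq {fset Zd},
  (forall e : R, 0 <= e -> ((9 * r.*2.+1) ^ d)%:R * e <= 2^-1 ->
     \sum_(S <- W) e ^+ #|` S| <= 4 * (((9 * r.*2.+1) ^ d)%:R * e)) /\
  forall b, (exists2 S, S \in W & forall s, s \in S -> b s) \/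
    (~ noisy_block r b 0 /\
     forall (Y : choiceType) (f : Zd -> Y), coherent (noisy_block r b) f -> f q = f 0).
Proof.
move=> d2 q0.
have [J HJ] : exists J, forall (Y : choiceType) b (f : Zd -> Y),
    coherent (noisy_block r b) f ->
    (forall j, (j <= J)%N -> ~ bad_at j (noisy_block r b) 0 /\
      ~ bad_at j (noisy_block r b) (ancestor j q)) -> f q = f 0.
  have [J qJ] := ancestor_nneg q0; by exists J => Y b f; exact: coherent_ancestors.
have [W HW] := choice (fun jQ : nat * Zd => witness_cover r jQ.1 jQ.2).
pose V j := W (j, 0) ++ W (j, ancestor j q).
exists (flatten [seq V j | j <- iota 0 J.+1]); split.
  move=> e e0; set th := _ * e => th2.
  have th0 : 0 <= th by rewrite mulr_ge0.
  have lev jQ : \sum_(S <- W jQ) e ^+ #|` S| <= th ^+ jQ.1.+1.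
    have [sz crd _] := HW jQ.
    rewrite (eq_big_seq (fun=> e ^+ (2 ^ jQ.1))); last by move=> S /crd[->].
    rewrite big_const_seq count_predT iter_addr_0 -mulr_natl.
    apply: le_trans (_ : th ^+ (2 ^ jQ.1) <= _).
      rewrite exprMn ler_wpM2r ?exprn_ge0// -natrX ler_nat.
      rewrite expnMn; apply: leq_trans sz; rewrite leq_pmull// expn_gt0//.
    rewrite ler_wiXn2l//; first by apply: le_trans th2 _; lra.
    exact: ltn_expl.
  rewrite big_flatten big_map.
  apply: le_trans (_ : \sum_(j <- iota 0 J.+1) 2 * th ^+ j.+1 <= _).
    apply: ler_sum => j _; rewrite big_cat/= mulr2n mulrDl mul1r.
    by rewrite lerD// ?(lev (j, 0)) ?(lev (j, ancestor j q)).
  (* The partial sums of the geometric series, with ratio at most one half. *)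
  suff : \sum_(j <- iota 0 J.+1) 2 * th ^+ j.+1 <= 4 * th - 4 * th * th ^+ J.+1.
    move/le_trans; apply; rewrite lerBlDr lerDl; by rewrite mulr_ge0 ?exprn_ge0// mulr_ge0.
  elim: J.+1 => [|n IHn]; first by rewrite big_nil expr0 mulr1 subrr.
  rewrite -addn1 iotaD big_cat/= big_seq1 add0n addn1.
  have p0 : 0 <= th ^+ n by rewrite exprn_ge0.
  have t0 : 0 <= 2^-1 - th by rewrite subr_ge0.
  have := mulr_ge0 (mulr_ge0 th0 p0) t0; move: IHn; rewrite !exprS.
  by move: (th ^+ n) (\sum_(j <- _) _) => y s; lra.
move=> b; have [ex|no] := pselect (exists2 S, S \in flatten [seq V j | j <- iota 0 J.+1] &
    forall s, s \in S -> b s); first by left.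
right.
have good j Q : (j <= J)%N -> Q = 0 \/ Q = ancestor j q -> ~ bad_at j (noisy_block r b) Q.
  move=> jJ Q01 bQ; apply: no; have [_ _ /(_ b bQ)[S SW Sb]] := HW (j, Q).
  exists S => //; apply/flatten_mapP; exists j; first by rewrite mem_iota add0n ltnS.
  by rewrite mem_cat; case: Q01 SW => -> ->; rewrite ?orbT.
split; first by apply: (good 0%N) => //; left.
by move=> Y f fc; apply: HJ fc _ => j jJ; split; apply: good => //; [left|right].
Qed.

End Witnesses.

(** * Completion of the central phase *)

Section AlmostSure.
Context (R : realType) dd (T : measurableType dd).
Variable P : probability T R.

Lemma rprob_le_as (X S S' : set T) : measurable X -> measurable S -> measurable S' ->
  P X = 1%E -> X `&` S `<=` S' -> rprob P S <= rprob P S'.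
Proof.
move=> mX mS mS' X1 XS.
have nX : rprob P (~` X) = 0 by rewrite /rprob probability_setC// X1 subee.
rewrite -[leRHS]addr0 -nX; apply: le_trans (rprobU_le _ mS' (measurableC mX)).
apply: rprob_mono => //; first by apply: measurableU => //; exact: measurableC.
by move=> z Sz; have [Xz|] := pselect (X z); [left; apply: XS|right].
Qed.

End AlmostSure.

Section Density.
Context (R : realType) (d : nat).
Local Notation Zd := 'rV[int]_d.
Implicit Types G T : set Zd.

Lemma density_eventually G (c c' : R) : (density R G <= c%:E)%E -> c < c' ->
  exists N0, forall N, (N0 <= N)%N ->
    (#|` fset_set (G `&` box N)|)%:R <= c' * ((N.*2.+1 ^ d)%N)%:R.
Proof.
rewrite /density limn_esup_lim; set u := (u in esups u) => dG cc'.
have [N0 HN0] : exists N0, (esups u N0 < c'%:E)%E.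
  apply: contrapT => no; have : (c'%:E <= limn (esups u))%E.
    apply: lime_ge; first exact: is_cvg_esups.
    by apply: nearW => n; rewrite leNgt; apply/negP => lt; apply: no; exists n.
  by move=> /le_trans/(_ dG); rewrite lee_fin leNgt cc'.
exists N0 => N N0N.
have : (u N <= c'%:E)%E.
  by apply: le_trans (ltW HN0); apply: ereal_sup_ubound; exists N.
by rewrite /u lee_fin ler_pdivrMr// ltr0n expn_gt0.
Qed.

(** A translate of the grid in a cube of side [N] embeds by translation in the grid
    in the centred box of radius [N], whose volume is at most [3 ^ d] times
    larger. *)
Lemma grid_count (p : nat) G (c c' : R) : 0 < c' ->
  (density R G <= c%:E)%E -> c < c' ->
  exists N0, forall N, (N0 <= N)%N -> forall T, grid_translates p G T ->
    (#|` [fset k in @fbox d 0 N | `[< T k >]]%fset|)%:R <= 3 ^+ d * c' * ((N ^ d)%N)%:R.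
Proof.
move=> c'0 dG cc'; have [N0 HN0] := density_eventually dG cc'.
exists (maxn N0 p.+1) => N; rewrite geq_max => /andP[N0N pN] T [t tp <-].
apply: (@le_trans _ _ (c' * ((N.*2.+1 ^ d)%N)%:R)); last first.
  rewrite [X in _ <= X * _]mulrC -[leRHS]mulrA; apply: ler_wpM2l; first exact: ltW.
  rewrite -natrX -natrM -expnMn ler_nat.
  by case: (d) => // d'; rewrite leq_exp2r//; lia.
apply: le_trans (HN0 N N0N); rewrite ler_nat.
have inj : injective (fun k : Zd => k - t) by move=> x y /addIr.
set S := [fset k in _ | _]%fset.
have <- : #|` [fset (k - t)%R | k in S]%fset| = #|` S| by rewrite card_imfset.
rewrite fsubset_leq_card//; apply/fsubsetP => _ /imfsetP[k /= + ->].
have fin : finite_set (G `&` @box d N).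
  by apply: sub_finite_set (@subIsetr _ _ _) _; rewrite boxE; exact: finite_fset.
rewrite !inE/= => /andP[/in_fbox kN /asboolP /mem_translate Gk].
rewrite in_fset_set// inE; split => // i; have := kN i; have := tp i.
by rewrite !coordE; lia.
Qed.

End Density.

Section NoisyMeasure.
Context (R : realType) (d : nat) (A : alphabetType).
Local Notation Zd := 'rV[int]_d.
Local Notation noisy := (borel_conf d (A * bool)%type).

Definition all_noisy (S : {fset Zd}) : set noisy :=
  [set z | forall s, s \in S -> (z s).2 = true].

Lemma all_noisy_measurable S : measurable (all_noisy S).
Proof.
apply: cylinder_measurable; exists S => x y xy Sx s sS.
by rewrite -xy//; exact: Sx.
Qed.

Lemma all_noisy_prob (lam : probability noisy R) (q : R) S : 0 <= q <= 1 ->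
  is_bernoulli_product q (pushforward lam (@conf2 d A bool)) ->
  rprob lam (all_noisy S) = q ^+ #|` S|.
Proof.
move=> q01 H; have := H S (fun=> [set true]).
have -> : pushforward lam (@conf2 d A bool)
    [set x | forall j, j \in S -> [set true] (x j)] = lam (all_noisy S) by [].
rewrite /rprob => ->.
have -> : bernoulli_prob q [set true] = q%:E.
  by rewrite /bernoulli_prob q01 fsbig_set1.
rewrite prodEFin/= big_const_seq count_predT -Monoid.iteropE.
by elim: (size _) => [|n IH]; rewrite ?expr0 //= exprS IH.
Qed.

End NoisyMeasure.

Section NoisyReconstruction.
Context (R : realType) (d : nat) (A : alphabetType).
Local Notation Zd := 'rV[int]_d.
Local Notation noisy := (borel_conf d (A * bool)%type).
Variables (F : {fset pattern d A}) (p C : nat) (rho : R) (G : set Zd).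
Hypothesis d_ge2 : (2 <= d)%N.
Hypothesis F_nonempty : SFT F !=set0.
Hypothesis p_gt0 : (0 < p)%N.
Hypothesis rho_gt0 : 0 < rho.
Hypothesis G_periodic : periodic_set p G.
Hypothesis G_density : (density R G <= rho%:E)%E.
Hypothesis F_reconstruction : reconstruction F p C G.

Let r := (uphalf p + C)%N.
Let phase := phase_of F p G.
Let ok := window_ok F p C.
(** Forgetting the cells outside the central window makes the completion of the
    central phase depend on finitely many cells only. *)
Let central (z : noisy) : conf d A :=
  fun j => if j \in @ball_at d 0 r then (z j).1 else point.

Lemma completion_exists : exists yT : conf d A -> conf d A * set Zd,
  forall x, [/\ SFT F (yT x).1, grid_translates p G (yT x).2 &
    ok x 0 -> phase x 0 = blank (yT x).2 (yT x).1].
Proof.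
have [y0 y0F] := F_nonempty.
suff H x : exists yT : conf d A * set Zd, [/\ SFT F yT.1, grid_translates p G yT.2 &
    ok x 0 -> phase x 0 = blank yT.2 yT.1] by have [f Hf] := choice H; exists f.
have [xok|nok] := pselect (ok x 0).
  have [y [T [yF gT e]]] := phase_of_completion F_reconstruction xok.
  by exists (y, T).
exists (y0, translate 0 G); split => //; exists 0 => // i.
by rewrite coordE lexx/= ltz_nat.
Qed.

Let cells (q : Zd) : Zd := q *+ r.*2.+1.

Lemma block_clear (z : noisy) (Q : Zd) : ~ noisy_block r (conf2 z) Q ->
  forall s, s \in ball_at (cells Q) r -> (z s).2 = false.
Proof.
by move=> nQ s sQ; case zs: (z s).2 => //; exfalso; apply: nQ; exists s.
Qed.

Lemma phase_coherent (z : noisy) : SFT (noisy_patterns F) z ->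
  coherent (noisy_block r (conf2 z)) (fun Q => phase (conf1 z) (cells Q)).
Proof.
move=> zF Q i /block_clear cQ /block_clear cQ'.
rewrite [cells (Q + _)]mulrnDl.
apply: (phase_of_walk p_gt0 G_periodic F_reconstruction) => [j|v vL].
  by rewrite !coordE; case: (j == i); lia.
apply: clear_window_ok => // j jr.
have [le|gt] := leP (v 0 i + j 0 i) r%:Z; [apply: cQ|apply: cQ']; apply/in_ball_at => l;
  have := vL l; have := jr l; rewrite /cells !coordE; have [->|_] := eqVneq l i => /=; lia.
Qed.

Let sideL : (0 : int) < (r.*2.+1)%:Z. Proof. by []. Qed.

(** The hierarchy of cells carries the phase of the origin to the cell [q] of [k],
    and a clear neighbourhood of that cell carries it to [k]; there the phase shows
    the symbol of [z], which is also that of the completion, unless [k] is on the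
    grid. *)
Lemma completion_close (yT : conf d A -> conf d A * set Zd) (k : Zd) :
  (forall x, [/\ SFT F (yT x).1, grid_translates p G (yT x).2 &
    ok x 0 -> phase x 0 = blank (yT x).2 (yT x).1]) ->
  (forall i, 0 <= k 0 i) ->
  exists W : seq {fset Zd},
  (forall e : R, 0 <= e -> ((9 * r.*2.+1) ^ d)%:R * e <= 2^-1 ->
     \sum_(S <- W) e ^+ #|` S| <= (4 * ((9 * r.*2.+1) ^ d) + ((3 * r).*2.+1 ^ d))%:R * e) /\
  forall z : noisy, SFT (noisy_patterns F) z -> (z k).1 <> (yT (central z)).1 k ->
    (exists2 S, S \in W & all_noisy S z) \/ (yT (central z)).2 k.
Proof.
move=> HyT k0.
pose q : Zd := \row_i divz (k 0 i) (r.*2.+1)%:Z.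
have q0 i : 0 <= q 0 i by rewrite mxE divz_ge0.
have [W [Wsum Wperc]] := percolation R r d_ge2 q0.
pose wide := @ball_at d (cells q) (3 * r).
exists (W ++ [seq [fset s]%fset | s <- wide]); split.
  move=> e e0 e2; rewrite big_cat/= natrD mulrDl lerD//.
    by apply: le_trans (Wsum e e0 e2) _; rewrite natrM mulrA.
  rewrite big_map (eq_bigr (fun=> e)); last by move=> s _; rewrite cardfs1 expr1.
  by rewrite big_const_seq count_predT iter_addr_0 card_ball_at mulr_natl.
move=> z zF zk; have [[S SW Sb]|[n0 fq]] := Wperc (conf2 z).
  by left; exists S => //; rewrite mem_cat SW.
have [[s sw bs]|nw] := pselect (exists2 s, s \in wide & (z s).2).
  left; exists [fset s]%fset.
    by rewrite mem_cat (map_f (fun s => [fset s]%fset)) ?orbT.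
  by move=> s'; rewrite inE => /eqP ->.
right; have cw s : s \in wide -> (z s).2 = false.
  by move=> sw; case zs: (z s).2 => //; exfalso; apply: nw; exists s.
have ok0 : ok (conf1 z) 0.
  apply: clear_window_ok => // j jr; apply: (block_clear n0); apply/in_ball_at => i.
  by have := jr i; rewrite /cells !coordE; lia.
pose s := k - cells q.
have sE i : 0 <= s 0 i < (r.*2.+1)%:Z.
  have := modz_ge0 (k 0 i) (lt0r_neq0 sideL); have := ltz_pmod (k 0 i) sideL.
  have := divz_eq (k 0 i) (r.*2.+1)%:Z; rewrite !coordE mxE.
  move: (modz _ _) (divz _ _) => m v; lia.
have walk (v : Zd) : (forall i, 0 <= v 0 i <= s 0 i) -> ok (conf1 z) (cells q + v).
  move=> vs; apply: clear_window_ok => // j jr; apply: cw; apply/in_ball_at => i.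
  rewrite !coordD; have := vs i; have := jr i; have := sE i.
  by move: (s 0 i) (v 0 i) (j 0 i) (cells q 0 i) => a b c e; lia.
have phk : phase (conf1 z) (cells q) = phase (conf1 z) k.
  rewrite -[X in _ = phase _ X](subrKC (cells q) k).
  apply: (phase_of_walk p_gt0 G_periodic F_reconstruction) => [i|]; last exact: walk.
  by case/andP: (sE i).
have okk : ok (conf1 z) k.
  rewrite -[k](subrKC (cells q) k); apply: walk => i.
  by case/andP: (sE i) => -> _ /=.
have ph0 : phase (conf1 z) k = phase (conf1 z) 0.
  by rewrite -phk (fq _ _ (phase_coherent zF)) /cells mul0rn.
have [okc phc] : ok (central z) 0 /\ phase (conf1 z) 0 = phase (central z) 0.
  apply: (phase_of_restrict p_gt0 G_periodic F_reconstruction) => // j jr.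
  rewrite /central add0r ifT//; apply/in_ball_at => i.
  by have := jr i; rewrite !coordE; lia.
have [_ _ /(_ okc) phB] := HyT (central z).
have := phase_of_centre F_reconstruction okk.
rewrite -/phase ph0 phc phB /blank; case: ifPn => [/set_mem //|_] [//|[e]].
by case: zk; rewrite e.
Qed.

(** The witness sets are entirely noisy with probability [O(e)] at each site, and
    the sites on the grid are few in each cube, for each configuration. *)
Lemma noisy_close : exists2 K : R, 0 <= K &
  forall (e : R) (lam : probability noisy R), noisy_joint_measures F e lam ->
  exists om : conf d (A * bool) -> conf d A,
  [/\ forall z, SFT F (om z), local_map om & exists N0, forall N, (N0 <= N)%N ->
    \sum_(k <- fbox 0 N) rprob lam [set z | (z k).1 <> om z k] <=
    (K * e + 3 ^+ d * (2 * rho)) * (N ^ d)%:R].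
Proof.
pose kap : R := ((9 * r.*2.+1) ^ d)%:R.
have [yT HyT] := completion_exists.
exists (4 * ((9 * r.*2.+1) ^ d) + ((3 * r).*2.+1 ^ d))%:R => // e lam.
move=> [[_ lam_full] [q [q01 qe lamq]]].
pose K : R := (4 * ((9 * r.*2.+1) ^ d) + ((3 * r).*2.+1 ^ d))%:R; rewrite -/K.
have q0 : 0 <= q by case/andP: q01.
have central_local (z z' : noisy) : agree (@ball_at d 0 r) z z' -> central z = central z'.
  by move=> zz'; apply: funext => j; rewrite /central; case: ifP => // /zz' ->.
exists (fun z => (yT (central z)).1); split.
- by move=> z; case: (HyT (central z)).
- by move=> j; exists (@ball_at d 0 r) => z z' /central_local ->.
have [N0 HN0] : exists N0, forall N, (N0 <= N)%N -> forall T, grid_translates p G T ->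
    (#|` [fset k in @fbox d 0 N | `[< T k >]]%fset|)%:R <=
    3 ^+ d * (2 * rho) * ((N ^ d)%N)%:R.
  by apply: (@grid_count R d p G rho (2 * rho)); rewrite ?mulr_gt0 ?ltr_pMl ?ltr1n.
exists N0 => N N0N.
pose X (k : Zd) : set noisy := [set z | (yT (central z)).2 k].
have mX k : measurable (X k).
  apply: cylinder_measurable; exists (@ball_at d 0 r) => z z' /central_local.
  by rewrite /X/= => ->.
have site (k : Zd) : k \in @fbox d 0 N ->
    rprob lam [set z | (z k).1 <> (yT (central z)).1 k] <= K * e + rprob lam (X k).
  move=> /in_fbox kN; have k0 i : 0 <= k 0 i by have := kN i; rewrite coordE; case/andP.
  have mD : measurable ([set z | (z k).1 <> (yT (central z)).1 k] : set noisy).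
    apply: cylinder_measurable; exists (k |` @ball_at d 0 r)%fset => z z' zz' /=.
    rewrite -(zz' k) ?inE ?eqxx// (@central_local z z')// => j jr.
    by apply: zz'; rewrite inE jr orbT.
  have [W [Wsum Wz]] := completion_close HyT k0.
  (* The weight bound on [W] asks for [kap * q <= 1/2]; beyond that, the constant
     [K] makes the claim trivial. *)
  have [big|small] := ltP 2^-1 (kap * q).
    apply: le_trans (rprob_le1 _ mD) _; rewrite -[leLHS]addr0 lerD ?rprob_ge0//.
    have : K * q <= K * e by rewrite ler_wpM2l.
    have : 4 * kap * q <= K * q.
      by rewrite ler_wpM2r// /K /kap -natrM ler_nat leq_addr.
    by lra.
  have mW (S : {fset Zd}) : measurable (all_noisy S : set noisy).
    exact: all_noisy_measurable.
  apply: le_trans (_ : rprob lam ((\big[setU/set0]_(S <- W) all_noisy S) `|` X k) <= _).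
    apply: (@rprob_le_as _ _ _ lam (SFT (noisy_patterns F))) => //.
    - exact: SFT_measurable.
    - by apply: measurableU => //; exact: bigsetU_measurable.
    move=> z [zF zk]; case: (Wz z zF zk) => [[S SW Sz]|]; last by right.
    by left; rewrite -bigcup_seq; exists S.
  apply: le_trans (rprobU_le _ _ _) _ => //; first exact: bigsetU_measurable.
  rewrite lerD2r; apply: le_trans (rprob_sum _ _) _ => //.
  under eq_bigr do rewrite (all_noisy_prob _ q01 lamq).
  by apply: le_trans (Wsum q q0 small) _; rewrite ler_wpM2l.
apply: le_trans (_ : \sum_(k <- fbox 0 N) (K * e + rprob lam (X k)) <= _).
  by rewrite big_seq [leRHS]big_seq; apply: ler_sum.
rewrite big_split/= mulrDl lerD//.
  by rewrite big_const_seq count_predT iter_addr_0 card_fbox mulr_natr.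
have := @probability_sum_le R _ noisy lam _ _ (fbox 0 N) [:: tt] X (fun=> setT) 1
  (3 ^+ d * (2 * rho) * (N ^ d)%:R).
rewrite mul1r big_seq1 rprob_setT mulr1; apply => //.
  by rewrite !mulr_ge0 ?exprn_ge0// ltW.
move=> z; rewrite mul1r big_seq1 indicT mulr1; have [_ gT _] := HyT (central z).
apply: le_trans (HN0 N N0N _ gT).
rewrite (big_fsetID _ (fun k => `[< X k z >]))/= [X in _ + X]big1_seq ?addr0; last first.
  by move=> k /andP[_]; rewrite !inE => /andP[_ /asboolP nX]; rewrite indicE memNset.
rewrite (eq_big_seq (fun=> 1)); last first.
  by move=> k; rewrite !inE => /andP[_ /asboolP Xk]; rewrite indicE mem_set.
by rewrite big_const_seq count_predT iter_addr_0.
Qed.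

End NoisyReconstruction.

(** * Stability *)

(** The completion of the central phase is turned into an invariant coupling by
    [limit_coupling], and [hamming_integral_le] estimates its cost. *)
Lemma noisy_besicovitch (R : realType) (d : nat) (A : alphabetType)
    (F : {fset pattern d A}) (p C : nat) (rho : R) (G : set 'rV[int]_d) :
  (2 <= d)%N -> SFT F !=set0 -> (0 < p)%N -> 0 < rho ->
  almost_periodic F p rho G -> reconstruction F p C G ->
  exists2 K : R, 0 <= K & forall (e t : R), 0 < t ->
    (ereal_sup [set besicovitch_set mu (invariant_measures F) | mu in noisy_measures F e]
      <= (t + 4 ^+ d * (K * e + 3 ^+ d * (2 * rho)) / t)%:E)%E.
Proof.
move=> d2 F0 p0 rho0 [Gp Gd _] FG.
have [K K0 HK] := noisy_close d2 F0 p0 rho0 Gp Gd FG.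
exists K => // e t t0; apply: ge_ereal_sup => _ [mu [lam lame lammu] <-].
have [om [omF oml omc]] := HK e lam lame.
have [[lam_inv _] _] := lame.
have [nu [nuF [Lam [Lamc Lamd]]]] := limit_coupling lam_inv lammu omF oml omc.
apply: le_trans (_ : besicovitch mu nu <= _)%E.
  by apply: ereal_inf_lbound; exists nu.
apply: le_trans (_ : \int[Lam]_z hamming R (conf1 z) (conf2 z) <= _)%E.
  by apply: ereal_inf_lbound; exists Lam.
have [Lam_inv _ _] := Lamc.
apply: le_trans (hamming_integral_le Lam_inv t0) _.
rewrite lee_fin lerD2l ler_pM2r ?invr_gt0// ler_wpM2l ?exprn_ge0//.
rewrite -lee_fin -rprobE//; apply: cylinder_measurable.
by exists [fset 0]%fset => x y xy /=; rewrite xy ?inE.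
Qed.

Theorem corollary4p2 (R : realType) (d : nat) (A : alphabetType)
    (F : {fset pattern d A}) (p : nat -> nat) (rho : nat -> R) (C : nat -> nat)
    (d_ge2 : (2 <= d)%N)
    (SFT_nonempty : SFT F !=set0)
    (p_ge1 : forall n, (1 <= p n)%N)
    (rho_gt0 : forall n, 0 < rho n)
    (almost_periodic_reconstruction : forall n, exists G : set 'rV[int]_d,
       almost_periodic F (p n) (rho n) G /\ reconstruction F (p n) (C n) G)
    (rho_to0 : rho n @[n --> \oo] --> (0 : R)) :
  stable R F.
Proof.
pose S (e : R) : \bar R := ereal_sup
  [set besicovitch_set mu (invariant_measures F) | mu in noisy_measures F e].
have S_le n : exists2 K : R, 0 <= K & forall (e t : R), 0 < t ->
    (S e <= (t + 4 ^+ d * (K * e + 3 ^+ d * (2 * rho n)) / t)%:E)%E.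
  have [G [FG FGr]] := almost_periodic_reconstruction n.
  exact: noisy_besicovitch FG FGr.
have S_small (c : R) : 0 < c ->
    exists2 e0 : R, 0 < e0 & forall e : R, e <= e0 -> (S e <= c%:E)%E.
  move=> c0; have a0 : 0 < (3 ^+ d * 2 * 4 ^+ d : R) by rewrite !mulr_gt0 ?exprn_gt0.
  pose a : R := 3 ^+ d * 2 * 4 ^+ d.
  (* With the threshold [c / 2], it suffices that the contributions of the grid and
     of the noise to the numerator are both at most [c ^+ 2 / 8]. *)
  have [n rn] : exists n, rho n * a <= c ^+ 2 / 8.
    have c8 : 0 < c ^+ 2 / 8 / a by rewrite !divr_gt0 ?exprn_gt0.
    have /cvgrPdist_le /(_ _ c8) [n _ Hn] := rho_to0.
    exists n; have := Hn n (leqnn n); rewrite sub0r normrN ger0_norm; last exact: ltW.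
    by rewrite ler_pdivlMr.
  have [K K0 HK] := S_le n.
  have b0 : 0 < 4 ^+ d * (K + 1) by rewrite mulr_gt0 ?exprn_gt0// ltr_wpDl.
  exists (c ^+ 2 / 8 / (4 ^+ d * (K + 1))); first by rewrite !divr_gt0 ?exprn_gt0.
  move=> e ee0; have c20 : 0 < c / 2 by rewrite divr_gt0.
  apply: le_trans (HK e _ c20) _; rewrite lee_fin.
  have Ke : 4 ^+ d * (K * e) <= c ^+ 2 / 8.
    have [e0|e0] := lerP e 0.
      apply: (@le_trans _ _ 0); last by rewrite divr_ge0 ?exprn_ge0// ltW.
      by rewrite mulr_ge0_le0 ?exprn_ge0// mulr_ge0_le0.
    move: ee0; rewrite ler_pdivlMr// => /(le_trans _); apply.
    rewrite -subr_ge0 [leRHS](_ : _ = e * 4 ^+ d); last by ring.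
    by rewrite mulr_ge0 ?exprn_ge0// ltW.
  have -> : 4 ^+ d * (K * e + 3 ^+ d * (2 * rho n)) = 4 ^+ d * (K * e) + rho n * a.
    by rewrite /a; ring.
  rewrite -lerBrDl ler_pdivrMr//.
  move: rn Ke; move: (rho n * a) (4 ^+ d * (K * e)) => x y; rewrite expr2; lra.
pose f (e : R) : R := fine (maxe 0%E (S e)).
have fE e : maxe 0%E (S e) = (f e)%:E.
  rewrite /f fineK//; have [K K0 /(_ e 1 ltr01) Se] := S_le 0%N.
  rewrite ge0_fin_numE ?le_max ?lexx// gt_max ltry/=.
  by apply: le_lt_trans Se _; rewrite ltry.
have f_ge0 e : 0 <= f e by rewrite -lee_fin -fE le_max lexx.
have f_le e c : 0 <= c -> (S e <= c%:E)%E -> f e <= c.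
  by move=> c0 Sc; rewrite -lee_fin -fE ge_max lee_fin c0.
have f0 : f 0 = 0.
  apply/eqP; rewrite eq_le f_ge0 andbT; apply/ler_addgt0Pr => c c0; rewrite add0r.
  by have [e0 e0_gt0 /(_ 0 (ltW e0_gt0))] := S_small c c0; apply: f_le; exact: ltW.
exists f; split => //.
- move=> e e' _ ee' _; rewrite -lee_fin -!fE ge_max !le_max lexx/=.
  apply/orP; right; apply: ereal_sup_le => _ [mu [lam [lamF [q [q01 qe lamq]]] lammu] <-].
  exists mu => //; exists lam => //; split => //; exists q; split => //.
  exact: le_trans qe ee'.
- rewrite f0; apply/cvgrPdist_le => c c0; have [e0 e0_gt0 He0] := S_small c c0.
  rewrite near_withinE; near=> e => _; rewrite sub0r normrN ger0_norm//.
  apply: f_le; [exact: ltW|apply: He0].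
  by near: e; exact: lt_le_nbhsl.
- by move=> e _; rewrite -fE le_max lexx orbT.
Unshelve. all: by end_near. Qed.
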